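(* Let $p$ be a prime. Let $d \ge 1$ and $n = (p-1)d - 1$ be integers. Fix some free $\mathbb{Z}/p$-action on $S^n$. Let $\Sigma$ be a $\mathbb{Z}/p$-equivariant triangulation of $S^n$ with vertex set $V$. Let $\ell \colon V \to [d] \times \mathbb{Z}/p$ be $\mathbb{Z}/p$-equivariant. Fix $s_1, \dots, s_d \in \mathbb{Z}/p$. Then either there is a $(p-1)$-face $\sigma$ of $\Sigma$ with $\ell(\sigma) = \{j\} \times \mathbb{Z}/p$ for some $j \in [d]$, or there is a facet $\sigma$ of $\Sigma$ with $\ell(\sigma) = \{(j, s) : j \in [d],\ s \in \mathbb{Z}/p \setminus \{s_j\}\}$.
   Context: $[d] = \{1,\dots,d\}$. An element $s \in \mathbb{Z}/p$ acts on $(j,t) \in [d] \times \mathbb{Z}/p$ by $s \cdot (j,t) = (j, t+s)$. A simplicial complex is a (finite) collection of finite sets closed under taking subsets; its elements are faces, a face with $k+1$ elements is a $k$-face, and inclusion-maximal faces are facets. A triangulation of $S^n$ is a simplicial complex whose geometric realization is homeomorphic to $S^n$. It is $\mathbb{Z}/p$-equivariant if it carries a simplicial self-map $\iota$ with $\iota^p = \mathrm{id}$ whose induced $\mathbb{Z}/p$-action on the geometric realization corresponds to the given action on $S^n$ under the homeomorphism; $s \in \mathbb{Z}/p$ acts on vertices by $\iota^s$. A $\mathbb{Z}/p$-action on a space is free if $s \cdot x \ne x$ for all $s \in \mathbb{Z}/p \setminus \{0\}$ and all points $x$. A map $\ell$ is $\mathbb{Z}/p$-equivariant if $\ell(s \cdot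 v) = s \cdot \ell(v)$ for all $s \in \mathbb{Z}/p$ and $v \in V$. *)

(* Defs.v *)
From HB Require Import structures.
From mathcomp Require Import all_boot all_order all_algebra.
From mathcomp Require Import all_classical all_reals all_analysis.
Set Implicit Arguments.
Unset Strict Implicit.
Unset Printing Implicit Defensive.
Import Order.TTheory GRing.Theory Num.Theory.
Import numFieldNormedType.Exports.
Local Open Scope ring_scope.

(* The topology of 'rV[R]_n.+1 is that of the sup norm, i.e. the usual one; the
   sphere itself is the Euclidean one.  Like any [set T], it is used below as a
   type, with the subspace topology. *)
Definition sphere (R : realType) (n : nat) : set 'rV[R]_n.+1 :=
  [set x : 'rV[R]_n.+1 | \sum_(i < n.+1) x ord0 i ^+ 2 = 1]%classic.
Arguments sphere R n : clear implicits.

Definition homeomorphism (X Y : topologicalType) (h : X -> Y) : Prop :=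
  exists g : Y -> X, [/\ cancel h g, cancel g h, continuous h & continuous g].

(* The empty set may be (and, if K is nonempty, is) a face. *)
Definition simplicial_complex (V : finType) (K : {set {set V}}) : Prop :=
  forall A B : {set V}, A \in K -> B \subset A -> B \in K.

Definition vertex_set (V : finType) (K : {set {set V}}) : Prop :=
  forall v : V, [set v]%SET \in K.

Definition kface (V : finType) (K : {set {set V}}) (k : nat) (A : {set V}) :
  Prop := A \in K /\ #|A| = k.+1.

Definition facet (V : finType) (K : {set {set V}}) (A : {set V}) : bool :=
  maxset (mem K) A.

Definition simplicial_map (V : finType) (K : {set {set V}}) (f : V -> V) :
  Prop := forall A : {set V}, A \in K -> (f @: A)%SET \in K.

(* Barycentric coordinates; {ptws V -> R} is R^V with the product topology. *)
Definition realization (R : realType) (V : finType) (K : {set {set V}}) :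
    set {ptws V -> R} :=
  [set x : {ptws V -> R} | [/\ forall v, 0 <= x v, \sum_v x v = 1
    & [set v | x v != 0]%SET \in K]]%classic.
Arguments realization R {V} K.

(* The affine extension of f, sending the vertex v to the vertex f v. *)
Definition pushforward (R : realType) (V : finType) (f : V -> V)
    (x : {ptws V -> R}) : {ptws V -> R} :=
  fun w => \sum_(v | f v == w) x v.

Lemma pushforward_realization (R : realType) (V : finType)
    (K : {set {set V}}) (f : V -> V) (fK : simplicial_map K f)
    (x : realization R K) :
  pushforward f (val x) \in realization R K.
Proof.
case: x => x /= /set_mem[x0 x1 xK]; apply/mem_set; split.
- by move=> w; apply: sumr_ge0.
- by rewrite -x1 [RHS](partition_big f xpredT).
- suff -> : [set w | pushforward f x w != 0]%SET
      = (f @: [set v | x v != 0])%SET by exact: fK.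
  apply/setP => w; rewrite inE psumr_neq0 //; apply/hasP/imsetP.
  + by case=> v _ /andP[/eqP <- xv]; exists v => //; rewrite inE gt_eqF.
  + case=> v; rewrite inE => xv ->; exists v; first exact: mem_index_enum.
    by rewrite eqxx lt_neqAle eq_sym xv x0.
Qed.

Definition realization_map (R : realType) (V : finType) (K : {set {set V}})
    (f : V -> V) (fK : simplicial_map K f) (x : realization R K) :
    realization R K :=
  exist (fun y => y \in realization R K) _ (pushforward_realization fK x).

(* Z/p is discrete, so continuity of the action is that of each translation. *)
Record continuous_action (p : nat) (X : topologicalType)
    (act : 'Z_p -> X -> X) : Prop := ContinuousAction {
  act_zero : forall x, act 0 x = x;
  act_add : forall s t x, act (s + t) x = act s (act t x);
  act_continuous : forall s, continuous (act s) }.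

Definition free_action (p : nat) (X : Type) (act : 'Z_p -> X -> X) : Prop :=
  forall (s : 'Z_p) (x : X), s != 0 -> act s x <> x.

(* Here h is the homeomorphism of the triangulation and iota the simplicial
   self-map carried by it. *)
Definition equivariant_triangulation (R : realType) (p : nat)
    (X : topologicalType) (act : 'Z_p -> X -> X) (V : finType)
    (K : {set {set V}}) (iota : V -> V) (h : realization R K -> X) : Prop :=
  [/\ simplicial_complex K, vertex_set K, homeomorphism h,
      forall v, iter p iota v = v
    & exists iotaK : simplicial_map K iota,
        forall (s : 'Z_p) (x : realization R K),
          h (iter s (realization_map iotaK) x) = act s (h x)].

Definition translate (p d : nat) (s : 'Z_p) (a : 'I_d * 'Z_p) : 'I_d * 'Z_p :=
  (a.1, a.2 + s).

Definition equivariant_labelling (p d : nat) (V : finType) (iota : V -> V)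
    (ell : V -> 'I_d * 'Z_p) : Prop :=
  forall (s : 'Z_p) (v : V), ell (iter s iota v) = translate s (ell v).

(* Main.v *)
(* Suppose that neither alternative holds.  A label set met by a face of Sigma
   then contains no full column {j} x Z/p and is not the transversal facet
   T = {(j, s) : s <> s_j}.  Assigning to each point of the sphere the label of a
   vertex with large barycentric coordinate, equivariantly, turns every tuple of
   close points into such a label set, so ordinary homology of Sigma can be
   replaced by chains of tuples of close points (Vietoris chains).

   Such chains are acyclic below dimension n on the boundary of a cube, by
   induction on the dimension and Mayer-Vietoris; all maps involved are clippings
   of coordinates, which do not increase distances, so no subdivision is needed.
   The usual recursion then gives small chains c_0, ..., c_n with
   d c_i = D_i c_(i-1), where D_i is g - 1 for odd i and the norm
   1 + g + ... + g^(p-1) for even i.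

   Their images in the complex of the label sets without full column, the join of
   d boundaries of (p-1)-simplices, satisfy the same relations.  There
   D_(n+1) c_n is a top-dimensional cycle that avoids T, hence zero, because the
   complex is a strongly connected pseudomanifold.  Since Z/p acts freely, the
   kernel of D_(i+1) is the image of D_i; descending from n to 0 writes c_0 as a
   boundary plus a norm, so its augmentation is a multiple of p, although it
   is 1. *)
Require Import Defs.
From HB Require Import structures.
From mathcomp Require Import all_boot all_order all_algebra.
From mathcomp Require Import all_classical all_reals all_analysis.
From mathcomp Require Import ring lra.
Import Order.TTheory GRing.Theory Num.Theory.
Import numFieldNormedType.Exports.
Set Implicit Arguments.
Unset Strict Implicit.
Unset Printing Implicit Defensive.

(** * Chains of tuples *)

Section WeightedCoboundary.
Local Open Scope ring_scope.
Variables (F : comNzRingType) (X : Type).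
Implicit Types (w u : X -> F) (f g : seq X -> F) (s : seq X).

(** The weights let one operator serve twice: constant weight 1 gives the simplicial coboundary,
    Kronecker deltas give the Laplace expansion of determinants in [minor]. *)
Fixpoint wcobord w f s {struct s} : F :=
  if s is x :: s' then w x * f s' - wcobord w (fun t => f (x :: t)) s' else 0.

(* The empty tuple is a simplex of dimension -1: homology is reduced. *)
Definition cobord := wcobord (fun=> 1).

Lemma eq_wcobord w f g s : f =1 g -> wcobord w f s = wcobord w g s.
Proof. by move=> /funext ->. Qed.

Lemma wcobord_lin w a f g s :
  wcobord w (fun t => a * f t + g t) s = a * wcobord w f s + wcobord w g s.
Proof.
elim: s f g => [|x s IHs] f g /=; first by rewrite mulr0 addr0.
by rewrite IHs !mulrDr !mulrN mulrCA opprD addrACA.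
Qed.

Lemma wcobordD w f g s :
  wcobord w (fun t => f t + g t) s = wcobord w f s + wcobord w g s.
Proof.
rewrite -[X in X + _]mul1r -wcobord_lin; apply: eq_wcobord => t.
by rewrite mul1r.
Qed.

Lemma wcobord0 w s : wcobord w (fun=> 0) s = 0.
Proof. by elim: s => //= x s ->; rewrite mulr0 subr0. Qed.

Lemma wcobordZ w a f s : wcobord w (fun t => a * f t) s = a * wcobord w f s.
Proof.
rewrite -[RHS]addr0 -(wcobord0 w s) -wcobord_lin; apply: eq_wcobord => t.
by rewrite addr0.
Qed.

Lemma wcobordN w f s : wcobord w (fun t => - f t) s = - wcobord w f s.
Proof.
by rewrite -mulN1r -wcobordZ; apply: eq_wcobord => t; rewrite mulN1r.
Qed.

Lemma wcobordB w f g s :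
  wcobord w (fun t => f t - g t) s = wcobord w f s - wcobord w g s.
Proof. by rewrite -wcobordN -wcobordD. Qed.

Lemma wcobord_sumw (I : finType) (P : pred I) (w : I -> X -> F) f s :
  wcobord (fun x => \sum_(i | P i) w i x) f s
    = \sum_(i | P i) wcobord (w i) f s.
Proof.
elim: s f => [|x s IHs] f /=; first by rewrite big1.
by rewrite IHs mulr_suml -sumrB.
Qed.

Lemma wcobord_anti w u f s :
  wcobord w (wcobord u f) s = - wcobord u (wcobord w f) s.
Proof.
elim: s f => [|x s IHs] f /=; first by rewrite oppr0.
rewrite !wcobordB !wcobordZ IHs; ring.
Qed.

(** Needs its own induction: [wcobord_anti] only says that twice the left side vanishes, which is no
    information when [p = 2]. *)
Lemma wcobordK w f s : wcobord w (wcobord w f) s = 0.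
Proof.
elim: s f => [|x s IHs] f //=.
by rewrite wcobordB wcobordZ IHs; ring.
Qed.

End WeightedCoboundary.

Lemma wcobord_map (F : comNzRingType) (X Y : Type) (phi : X -> Y) (w : Y -> F)
    (f : seq Y -> F) (s : seq X) :
  wcobord w f (map phi s)
    = wcobord (fun x => w (phi x)) (fun t => f (map phi t)) s.
Proof. by elim: s f => //= x s IHs f; rewrite IHs. Qed.

(* Chains with coefficients in F on tuples of points of X are represented by
   the linear forms they induce on cochains, so that equality of chains is
   equality of functions and operators on chains are given by their
   transposes. *)
Section Chains.
Local Open Scope ring_scope.
Variables (F : comNzRingType) (X : eqType).
Implicit Types (P Q : seq X -> Prop) (f g : seq X -> F) (s t : seq X).

Inductive chain_on P : ((seq X -> F) -> F) -> Prop :=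
| chain_on_nil : chain_on P (fun=> 0)
| chain_on_cons a t c :
    P t -> chain_on P c -> chain_on P (fun f => a * f t + c f).

Lemma eq_chain P c c' : c =1 c' -> chain_on P c -> chain_on P c'.
Proof. by move=> /funext ->. Qed.

Lemma chain_sub P Q c : (forall t, P t -> Q t) -> chain_on P c -> chain_on Q c.
Proof.
by move=> PQ; elim=> [|a t c' /PQ Qt _ IHc]; [left | right].
Qed.

Lemma chain1 P t : P t -> chain_on P (fun f => f t).
Proof.
move=> Pt; apply: eq_chain (chain_on_cons 1 Pt (chain_on_nil P)) => f.
by rewrite mul1r addr0.
Qed.

Lemma chainD P c c' :
  chain_on P c -> chain_on P c' -> chain_on P (fun f => c f + c' f).
Proof.
move=> cP c'P; elim: cP => [|a t c'' Pt _ IHc].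
  by apply: eq_chain c'P => f; rewrite add0r.
by apply: eq_chain (chain_on_cons a Pt IHc) => f; rewrite addrA.
Qed.

Lemma chainZ P a c : chain_on P c -> chain_on P (fun f => a * c f).
Proof.
elim=> [|b t c' Pt _ IHc]; first by apply: eq_chain (chain_on_nil P) => f;
  rewrite mulr0.
apply: eq_chain (chain_on_cons (a * b) Pt IHc) => f.
by rewrite mulrDr mulrA.
Qed.

Lemma chainN P c : chain_on P c -> chain_on P (fun f => - c f).
Proof. by move=> /(chainZ (-1)); apply: eq_chain => f; rewrite mulN1r. Qed.

Lemma chainB P c c' :
  chain_on P c -> chain_on P c' -> chain_on P (fun f => c f - c' f).
Proof. by move=> cP /chainN; apply: chainD. Qed.

Lemma chain_sum (I : finType) P (c : I -> (seq X -> F) -> F) :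
  (forall i, chain_on P (c i)) -> chain_on P (fun f => \sum_i c i f).
Proof.
move=> cP; suff H (r : seq I) : chain_on P (fun f => \sum_(i <- r) c i f) by exact: H.
elim: r => [|i r IHr].
  by apply: eq_chain (chain_on_nil P) => f; rewrite big_nil.
by apply: eq_chain (chainD (cP i) IHr) => f; rewrite big_cons.
Qed.

Lemma chain_lin P c a f g :
  chain_on P c -> c (fun t => a * f t + g t) = a * c f + c g.
Proof.
elim=> [|b t c' _ _ ->]; first by rewrite mulr0 addr0.
by ring.
Qed.

Lemma chain_zero P c : chain_on P c -> c (fun=> 0) = 0.
Proof. by elim=> // b t c' _ _ ->; rewrite mulr0 addr0. Qed.

Lemma chain_add P c f g :
  chain_on P c -> c (fun t => f t + g t) = c f + c g.
Proof.
move=> cP; rewrite -[c f]mul1r -(chain_lin 1 f g cP).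
by congr c; apply/funext => t; rewrite mul1r.
Qed.

Lemma chain_scale P c a f : chain_on P c -> c (fun t => a * f t) = a * c f.
Proof.
move=> cP; rewrite -[RHS]addr0 -(chain_zero cP) -(chain_lin _ _ _ cP).
by congr c; apply/funext => t; rewrite addr0.
Qed.

Lemma chain_opp P c f : chain_on P c -> c (fun t => - f t) = - c f.
Proof.
move=> cP; rewrite -mulN1r -(chain_scale _ _ cP); congr c.
by apply/funext => t; rewrite mulN1r.
Qed.

Lemma chain_sub_fun P c f g :
  chain_on P c -> c (fun t => f t - g t) = c f - c g.
Proof. by move=> cP; rewrite (chain_add f (fun t => - g t) cP) (chain_opp _ cP). Qed.

Lemma chain_sumf (I : finType) P c (Pr : pred I) (f : I -> seq X -> F) :
  chain_on P c -> c (fun t => \sum_(i | Pr i) f i t) = \sum_(i | Pr i) c (f i).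
Proof.
elim=> [|b t c' _ _ ->]; first by rewrite big1.
by rewrite mulr_sumr -big_split.
Qed.

Lemma chain_ext P c f g :
  chain_on P c -> (forall t, P t -> f t = g t) -> c f = c g.
Proof. by move=> cP fg; elim: cP => // b t c' /fg -> _ ->. Qed.

End Chains.

(** [T] is the transpose of an operator from tuples to chains, so the support of the image of [c]
    can be checked on single tuples. *)
Lemma chain_bind (F : comNzRingType) (X Y : eqType) (P : seq X -> Prop)
    (Q : seq Y -> Prop) (T : (seq Y -> F) -> seq X -> F) c :
    (forall t, P t -> chain_on Q (fun f => T f t)) ->
  chain_on P c -> chain_on Q (fun f => c (T f)).
Proof.
move=> PQ; elim=> [|a t c' Pt _ IHc]; first by left.
by apply: chainD => //; apply: chainZ; apply: PQ.
Qed.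

Section Homotopy.
Local Open Scope ring_scope.
Variables (F : comNzRingType) (X : eqType).
Implicit Types (f : seq X -> F) (s t : seq X).

Definition closed_chain (c : (seq X -> F) -> F) := forall f, c (cobord f) = 0.

Lemma chain_cobord (P Q : seq X -> Prop) c :
    (forall t s, P t -> subseq s t -> size t = (size s).+1 -> Q s) ->
  chain_on P c -> chain_on Q (fun f : seq X -> F => c (cobord f)).
Proof.
move=> PQ; apply: chain_bind => t /PQ {PQ}.
elim: t Q => [|x t IHt] Q Qt /=; first by left.
apply: chainB.
  by apply: chainZ; apply: chain1; apply: Qt => //; rewrite subseq_cons.
(* The remaining faces keep [x]; they are [x] prepended to the faces of [t], whence the changed
   predicate. *)
have := IHt (fun s => Q (x :: s)) _.
move=> /(_ _)/(chain_bind (Q := Q) (T := fun f s => f (x :: s))) H.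
apply: H; first by move=> s Qxs; apply: chain1.
by move=> s st sz; apply: Qt; rewrite /= ?eqxx ?sz.
Qed.

Variable phi : X -> X.

(* Transpose of the prism operator, which maps x_0 ... x_k to the alternating
   sum of the x_0 ... x_i (phi x_i) ... (phi x_k). *)
Fixpoint prism f s : F :=
  if s is x :: s' then f (x :: phi x :: map phi s') - prism (fun t => f (x :: t)) s'
  else 0.

Lemma prismB f g s : prism (fun t => f t - g t) s = prism f s - prism g s.
Proof.
by elim: s f g => [|x s IHs] f g /=; [rewrite subr0 | rewrite IHs; ring].
Qed.

(** The prism operator is a chain homotopy between the identity and the map induced by [phi].
    Splitting off the first entry leaves the same identity for [fx] on the tail. *)
Lemma cobord_prism f s :
  prism (cobord f) s + cobord (prism f) s = f (map phi s) - f s.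
Proof.
elim: s f => [|x s IHs] f; first by rewrite /= addr0 subrr.
set fx := fun t => f (x :: t); have fxE t : f (x :: t) = fx t by [].
have cobordE g : cobord g (x :: s) = g s - cobord (fun t => g (x :: t)) s.
  by rewrite /cobord /= mul1r.
rewrite cobordE.
have -> : cobord (fun t => prism f (x :: t)) s
    = cobord (fun t => fx (phi x :: map phi t)) s - cobord (prism fx) s.
  exact: wcobordB.
have -> : prism (cobord f) (x :: s)
    = f (phi x :: map phi s) - cobord fx (phi x :: map phi s)
      - (prism f s - prism (cobord fx) s).
  rewrite [LHS]/= -prismB /cobord /= mul1r; congr (_ - prism _ _).
  by apply/funext => t; rewrite mul1r.
rewrite {1}/cobord [wcobord _ fx _]/= wcobord_map -/(cobord _) mul1r !fxE.
have -> : fx s = fx (map phi s) - (prism (cobord fx) s + cobord (prism fx) s).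
  by rewrite IHs; ring.
rewrite [map phi _]/= /cobord; ring.
Qed.

Lemma chain_prism (P Q : seq X -> Prop) c :
    (forall t s, P t -> {subset s <= t ++ map phi t} -> size s = (size t).+1 -> Q s) ->
  chain_on P c -> chain_on Q (fun f : seq X -> F => c (prism f)).
Proof.
move=> PQ; apply: chain_bind => t /PQ {PQ}.
elim: t Q => [|x t IHt] Q Qt /=; first by left.
apply: chainB.
  apply: chain1; apply: Qt => /=; last by rewrite size_map.
  move=> y; rewrite !inE mem_cat inE => /or3P[->|->|->] //=; rewrite ?orbT //.
have := IHt (fun s => Q (x :: s)) _.
move=> /(_ _)/(chain_bind (Q := Q) (T := fun f s => f (x :: s))) H.
apply: H; first by move=> s Qxs; apply: chain1.
move=> s st sz; apply: Qt; rewrite /= ?sz // => y.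
rewrite !inE => /orP[->//|/st]; rewrite !mem_cat inE => /orP[->|->]; by rewrite ?orbT.
Qed.

End Homotopy.

(** * Chains of tuples of close points: cones and homotopies *)

Section SmallChains.
Local Open Scope ring_scope.
Variables (F : comNzRingType) (R : realType) (N : nat).
Local Notation X := 'rV[R]_N.
Implicit Types (A B : X -> Prop) (d e : R) (k : nat) (x y : X)
  (z w : (seq X -> F) -> F).

Definition near_pts d x y := forall i, `|x 0 i - y 0 i| <= d.

(** [k] counts entries, so these simplices have dimension [k - 1]; accordingly [bounds] fills chains
    of [k]-tuples by chains of [k.+1]-tuples. *)
Definition small A d k (s : seq X) :=
  [/\ size s = k, forall x, x \in s -> A x
    & forall x y, x \in s -> y \in s -> near_pts d x y].

Definition bounds A e k z :=
  exists2 w, chain_on (small A e k.+1) w & forall f, w (cobord f) = z f.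

Lemma near_sym d x y : near_pts d x y -> near_pts d y x.
Proof. by move=> xy i; rewrite distrC. Qed.

Lemma near_refl d x : 0 <= d -> near_pts d x x.
Proof. by move=> d0 i; rewrite subrr normr0. Qed.

Lemma near_trans d e x y t :
  near_pts d x y -> near_pts e y t -> near_pts (d + e) x t.
Proof.
move=> xy yt i; rewrite -(subrKA (y 0 i)).
by apply: le_trans (ler_normD _ _) _; apply: lerD.
Qed.

Lemma near_le d e x y : d <= e -> near_pts d x y -> near_pts e x y.
Proof. by move=> de xy i; apply: le_trans de. Qed.

Lemma small_sub A B d e k s :
  (forall x, A x -> B x) -> d <= e -> small A d k s -> small B e k s.
Proof.
move=> AB de [sz sA sd]; split=> //; first by move=> x /sA/AB.
by move=> x y xs ys; apply: near_le de _; apply: sd.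
Qed.

Lemma small_map A B d e k (phi : X -> X) s :
    (forall x, A x -> B (phi x)) ->
    (forall x y, A x -> A y -> near_pts d x y -> near_pts e (phi x) (phi y)) ->
  small A d k s -> small B e k (map phi s).
Proof.
move=> AB de [sz sA sd]; split; first by rewrite size_map.
  by move=> _ /mapP[x /sA/AB ? ->].
by move=> _ _ /mapP[x xs ->] /mapP[y ys ->]; apply: de; auto.
Qed.

Lemma chain_map A B d e k (phi : X -> X) z :
    (forall x, A x -> B (phi x)) ->
    (forall x y, A x -> A y -> near_pts d x y -> near_pts e (phi x) (phi y)) ->
  chain_on (small A d k) z ->
  chain_on (small B e k) (fun f => z (fun s => f (map phi s))).
Proof.
move=> AB de; apply: chain_bind => t tA; apply: chain1.
exact: small_map tA.
Qed.

Lemma cobord_map (phi : X -> X) (f : seq X -> F) s :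
  cobord f (map phi s) = cobord (fun s => f (map phi s)) s.
Proof. by rewrite /cobord wcobord_map. Qed.

Lemma closed_chain_map (phi : X -> X) z :
  closed_chain z -> closed_chain (fun f => z (fun s => f (map phi s))).
Proof.
move=> zc f; rewrite -[RHS](zc (fun s => f (map phi s))).
by congr z; apply/funext => s; rewrite cobord_map.
Qed.

Lemma bounds_sub A B d e k z :
  (forall x, A x -> B x) -> d <= e -> bounds A d k z -> bounds B e k z.
Proof.
move=> AB de [w wA wz]; exists w => //; apply: chain_sub wA => t.
exact: small_sub.
Qed.

(** The boundary of the cone with apex [q] over [z] is [z] minus the cone over the boundary of [z],
    which is zero. *)
Lemma bounds_cone (P : seq X -> Prop) A e k q z :
    (forall t, P t -> small A e k.+1 (q :: t)) ->
  chain_on P z -> closed_chain z -> bounds A e k z.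
Proof.
move=> PA zP zc; exists (fun f => z (fun t => f (q :: t))).
  by apply: chain_bind zP => t /PA; apply: chain1.
move=> f; rewrite -[RHS]subr0 -[in RHS](zc (fun t => f (q :: t))).
rewrite -(chain_sub_fun _ _ zP); congr z; apply/funext => t.
by rewrite /cobord /= mul1r.
Qed.

(** Subtracting the prism over [z] from a filling of its image under [phi] gives a filling of [z].
    Entries of the prism are at most [d + a] apart when [phi] displaces only one of them. *)
Lemma bounds_homotopy A B d a e k (phi : X -> X) z :
    0 <= a -> 0 <= d -> d + a <= e ->
    (forall x, B x -> A x) -> (forall x, B x -> A (phi x)) ->
    (forall x, B x -> near_pts a x (phi x)) ->
    (forall x y, B x -> B y -> near_pts d x y -> near_pts e (phi x) (phi y)) ->
  chain_on (small B d k) z -> closed_chain z ->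
  bounds A e k (fun f => z (fun s => f (map phi s))) -> bounds A e k z.
Proof.
move=> a0 d0 dae BA BphiA Ba Bphi zB zc [w wA wz].
exists (fun f => w f - z (prism phi f)); last first.
  move=> f; rewrite wz -(chain_sub_fun _ _ zB).
  rewrite -[RHS]subr0 -(zc (prism phi f)) -(chain_sub_fun _ _ zB).
  have E s : f (map phi s) - prism phi (cobord f) s = f s + cobord (prism phi f) s.
    by rewrite -[f (map phi s)](subrK (f s)) -cobord_prism; ring.
  rewrite (_ : (fun t => _) = (fun s => f s + cobord (prism phi f) s)); last exact/funext.
  by rewrite (chain_add _ _ zB) (chain_sub_fun _ _ zB) zc addr0 subr0.
apply: chainB => //; apply: chain_prism zB => t s [szt tB td] st szs.
have tphi u : u \in s -> exists2 x, x \in t & u = x \/ u = phi x.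
  by move=> /st; rewrite mem_cat => /orP[ut|/mapP[x xt ->]];
     [exists u; auto|exists x; auto].
split; first by rewrite szs szt.
  by move=> u /tphi[x /tB Bx [->|->]]; auto.
move=> u v /tphi[x xt ux] /tphi[y yt vy].
have xy := td _ _ xt yt; have [Bx By] := (tB _ xt, tB _ yt).
have de : d <= e by apply: le_trans dae; rewrite lerDl.
case: ux vy => -> [] ->.
- exact: near_le xy.
- by apply: near_le dae _; apply: near_trans xy _; apply: Ba.
- rewrite addrC in dae; apply: near_le dae _; apply: near_trans xy.
  by apply: near_sym; apply: Ba.
- exact: Bphi.
Qed.

End SmallChains.

(** * Acyclicity of the boundary of a cube *)

Section CubeBoundary.
Local Open Scope ring_scope.
Variables (F : comNzRingType) (R : realType) (N : nat).
Local Notation X := 'rV[R]_N.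
Implicit Types (d e r a b c : R) (k : nat) (x y : X) (z : (seq X -> F) -> F).

(* The boundary of the cube [-1, 1]^(m+1) in the first m + 1 coordinates. *)
Definition cube_boundary (m : nat) x :=
  [/\ forall i, `|x 0 i| <= 1, exists i, `|x 0 i| = 1
    & forall i : 'I_N, (m < i)%N -> x 0 i = 0].

Lemma ler_dist_max a b c d : `|a - b| <= d -> `|Num.max a c - Num.max b c| <= d.
Proof.
rewrite !ler_norml => /andP[H1 H2]; rewrite !maxEle.
by case: (leP a c) => ?; case: (leP b c) => ?; apply/andP; split; lra.
Qed.

Lemma ler_dist_min a b c d : `|a - b| <= d -> `|Num.min a c - Num.min b c| <= d.
Proof.
rewrite !ler_norml => /andP[H1 H2]; rewrite !minEle.
by case: (leP a c) => ?; case: (leP b c) => ?; apply/andP; split; lra.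
Qed.

(* The half of the boundary where sg * x_m >= 0 is contracted by first raising
   x_m to sg, which ends in a face of the cube, then shrinking the face to its
   centre; both are clippings of coordinates, done in steps of size a. *)
Section Half.
Variables (m : 'I_N) (sg : R).
Hypothesis sg1 : sg * sg = 1.

Lemma norm_sg : `|sg| = 1.
Proof.
have : (sg - 1) * (sg + 1) == 0 by apply/eqP; ring: sg1.
by rewrite mulf_eq0 subr_eq0 addr_eq0 => /orP[] /eqP ->; rewrite ?normrN normr1.
Qed.

Lemma norm_sgM a : `|sg * a| = `|a|.
Proof. by rewrite normrM norm_sg mul1r. Qed.

Lemma sgK a : sg * (sg * a) = a.
Proof. by rewrite mulrA sg1 mul1r. Qed.

Definition half_cube x := cube_boundary m x /\ 0 <= sg * x 0 m.

Definition raise c x : X :=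
  \row_i if i == m then sg * Num.max (sg * x 0 m) c else x 0 i.

Definition shrink r x : X :=
  \row_i if i == m then x 0 i else Num.max (Num.min (x 0 i) r) (- r).

Definition raised c x := half_cube x /\ c <= sg * x 0 m.

Definition top r x :=
  [/\ cube_boundary m x, sg * x 0 m = 1 & forall i, i != m -> `|x 0 i| <= r].

Lemma raise_near c d x y : near_pts d x y -> near_pts d (raise c x) (raise c y).
Proof.
move=> xy i; rewrite !mxE; case: eqP => // _.
rewrite -mulrBr norm_sgM; apply: ler_dist_max.
by rewrite -mulrBr norm_sgM.
Qed.

Lemma shrink_near r d x y : near_pts d x y -> near_pts d (shrink r x) (shrink r y).
Proof.
move=> xy i; rewrite !mxE; case: eqP => // _.
by apply: ler_dist_max; apply: ler_dist_min.
Qed.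

Lemma half_le1 x : half_cube x -> sg * x 0 m <= 1.
Proof. by case=> -[x1 _ _] _; apply: le_trans (x1 m); rewrite -norm_sgM ler_norm. Qed.

Lemma raise_raised c x : c <= 1 -> half_cube x -> raised c (raise c x).
Proof.
move=> c1 hx; have xm1 := half_le1 hx; case: hx => -[x1 [i0 xi0] xm] x0.
have E : sg * raise c x 0 m = Num.max (sg * x 0 m) c by rewrite mxE eqxx sgK.
split; last by rewrite E le_max lexx orbT.
split; last by rewrite E le_max x0.
have M1 : Num.max (sg * x 0 m) c <= 1 by rewrite ge_max xm1.
have M0 : 0 <= Num.max (sg * x 0 m) c by rewrite le_max x0.
split.
- move=> i; rewrite !mxE; case: eqP => // _.
  by rewrite norm_sgM ger0_norm.
(* If the coordinate of absolute value 1 is the one at [m], it already equals [sg] in this half and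
   raising leaves it in place. *)
- exists i0; rewrite !mxE; case: eqP => // i0m.
  have x1m : sg * x 0 m = 1 by rewrite -i0m in x0 *; rewrite -xi0 -norm_sgM ger0_norm.
  by rewrite norm_sgM x1m max_l // normr1.
- move=> i mi; rewrite !mxE; case: eqP => [im|_]; last exact: xm.
  by rewrite im ltnn in mi.
Qed.

Lemma raise_move c a x :
  0 <= a -> c - a <= sg * x 0 m -> near_pts a x (raise c x).
Proof.
move=> a0 ca i; rewrite mxE; case: eqP => [->|_]; last by rewrite subrr normr0.
rewrite -norm_sgM mulrBr sgK maxEle; case: (leP (sg * x 0 m) c) => ?; last by rewrite subrr normr0.
by rewrite ler_norml; apply/andP; split; lra.
Qed.

Lemma shrink_top r r' x : 0 <= r -> top r' x -> top r (shrink r x).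
Proof.
move=> r0 [[x1 _ xm] x1m _]; split; last 2 first.
- by rewrite mxE eqxx.
- move=> i /negPf im; rewrite mxE im ler_norml !maxEle !minEle.
  by case: (leP (x 0 i) r) => ?; case: (leP _ (- r)) => ?; apply/andP; split; lra.
split.
- move=> i; rewrite mxE; case: eqP => // _; have := x1 i.
  rewrite !ler_norml => /andP[? ?]; rewrite !maxEle !minEle.
  by case: (leP (x 0 i) r) => ?; case: (leP _ (- r)) => ?; apply/andP; split; lra.
- by exists m; rewrite mxE eqxx -norm_sgM x1m normr1.
- move=> i mi; rewrite mxE; case: eqP => [im|_]; first by rewrite im ltnn in mi.
  by rewrite xm // min_l // max_l // oppr_le0.
Qed.

Lemma shrink_move r a x : 0 <= a -> 0 <= r -> top (r + a) x -> near_pts a x (shrink r x).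
Proof.
move=> a0 r0 [_ _ xr] i; rewrite mxE; case: eqP => [_|/eqP /xr]; first by rewrite subrr normr0.
rewrite !ler_norml => /andP[? ?]; rewrite !maxEle !minEle.
by case: (leP (x 0 i) r) => ?; case: (leP _ (- r)) => ?; apply/andP; split; lra.
Qed.

Lemma top_half r x : top r x -> half_cube x.
Proof. by case=> *; split=> //; lra. Qed.

(** Induction on the number of shrinking steps, down to the centre of the face, where a cone is
    available. As shrinking keeps tuples [d]-small, the filling loses a single [a] in size, whatever
    [j] is. *)
Lemma top_bounds d a e k z j : 0 <= d -> 0 < a -> d + a <= e ->
  chain_on (small (top (j%:R * a)) d k) z -> closed_chain z -> bounds half_cube e k z.
Proof.
move=> d0 a0 dae; elim: j z => [|j IHj] z zB zc.
  pose q : X := \row_i if i == m then sg else 0.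
  have qE x : top (0%:R * a) x -> x = q.
    case=> _ x1 xm; apply/rowP => i; rewrite mxE; case: eqP => [->|/eqP/xm].
      by rewrite -[LHS]sgK x1 mulr1.
    by rewrite mul0r normr_le0 => /eqP.
  have tq : half_cube q.
    have qm : sg * q 0 m = 1 by rewrite mxE eqxx.
    split; last by rewrite qm.
    split.
    - by move=> i; rewrite mxE; case: eqP; rewrite ?norm_sg ?normr0.
    - by exists m; rewrite mxE eqxx norm_sg.
    - by move=> i mi; rewrite mxE; case: eqP => // im; rewrite im ltnn in mi.
  apply: (bounds_cone (q := q) _ zB zc) => t [sz tB _].
  have tE x : x \in q :: t -> x = q by rewrite inE => /orP[/eqP|/tB/qE].
  split=> /=; [by rewrite sz|by move=> x /tE ->|move=> x y /tE -> /tE ->].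
  by apply: near_refl; lra.
have ja : 0 <= j%:R * a by rewrite mulr_ge0 // ltW.
have jE : j.+1%:R * a = j%:R * a + a by rewrite -natr1 mulrDl mul1r.
have de : d <= e by lra.
apply: (bounds_homotopy (B := top (j.+1%:R * a)) (phi := shrink (j%:R * a))
         (ltW a0) d0 dae _ _ _ _ zB zc).
- by move=> x /top_half.
- by move=> x /(shrink_top ja)/top_half.
- by rewrite jE => x; apply: shrink_move => //; apply: ltW.
- by move=> x y _ _ xy; apply: near_le de _; apply: shrink_near.
apply: IHj; last exact: closed_chain_map.
apply: chain_map zB; first by move=> x /(shrink_top ja).
by move=> x y _ _; apply: shrink_near.
Qed.

(** Each step raises the lower bound on [sg * x 0 m] by [a]. After the last one all points lie in
    the face, of half-width 1, which [J] shrinking steps exhaust. *)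
Lemma raised_bounds d a e k z j J : 0 <= d -> 0 < a -> d + a <= e ->
    1 <= J%:R * a ->
  chain_on (small (raised (1 - j%:R * a)) d k) z -> closed_chain z ->
  bounds half_cube e k z.
Proof.
move=> d0 a0 dae J1; elim: j z => [|j IHj] z zB zc.
  apply: (top_bounds (j := J) d0 a0 dae _ zc); apply: chain_sub zB => t.
  apply: small_sub => // x [hx xm]; have xm1 := half_le1 hx.
  case: hx => Qx _; split => //; first by lra.
  by move=> i _; case: Qx => x1 _ _; apply: le_trans J1.
have jE : j.+1%:R * a = j%:R * a + a by rewrite -natr1 mulrDl mul1r.
have ja : 0 <= j%:R * a by rewrite mulr_ge0 // ltW.
have j1 : 1 - j%:R * a <= 1 by lra.
have de : d <= e by lra.
apply: (bounds_homotopy (B := raised (1 - j.+1%:R * a)) (phi := raise (1 - j%:R * a))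
         (ltW a0) d0 dae _ _ _ _ zB zc).
- by move=> x [].
- by move=> x [hx _]; have [] := raise_raised j1 hx.
- by move=> x [hx xm]; apply: raise_move => //; [exact: ltW|lra].
- by move=> x y _ _ xy; apply: near_le de _; apply: raise_near.
apply: IHj; last exact: closed_chain_map.
apply: chain_map zB; first by move=> x [hx _]; apply: raise_raised.
by move=> x y _ _; apply: raise_near.
Qed.

Lemma half_bounds d e k z : 0 <= d -> d < e ->
  chain_on (small half_cube d k) z -> closed_chain z -> bounds half_cube e k z.
Proof.
(* The steps have size [e - d], the slack allowed to the filling; by the Archimedean property
   finitely many of them cover length 1. *)
move=> d0 de zH zc; have a0 : 0 < e - d by rewrite subr_gt0.
have J1 : 1 <= (Num.bound (e - d)^-1)%:R * (e - d).
  rewrite -ler_pdivrMr // div1r; apply: ltW; apply: archi_boundP.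
  by rewrite invr_ge0 ltW.
apply: (raised_bounds (j := Num.bound (e - d)^-1) d0 a0 _ J1 _ zc).
  by rewrite subrKC.
apply: chain_sub zH => t; apply: small_sub => // x hx; split=> //.
by case: hx => _; apply: le_trans; rewrite subr_le0.
Qed.

End Half.
End CubeBoundary.

(** * Mayer-Vietoris for the two halves of the boundary of a cube *)

Section MayerVietoris.
Local Open Scope ring_scope.
Variables (F : comNzRingType).

Lemma chain_split (X : eqType) (P P1 P2 : seq X -> Prop) (c : (seq X -> F) -> F) :
    (forall t, P t -> P1 t \/ P2 t) -> chain_on P c ->
  exists c1 c2, [/\ chain_on P1 c1, chain_on P2 c2 & forall f, c f = c1 f + c2 f].
Proof.
move=> PP; elim=> [|a t c' Pt _ [c1 [c2 [cP1 cP2 cE]]]].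
  by exists (fun=> 0), (fun=> 0); split=> [||f]; [left|left|rewrite addr0].
case: (PP _ Pt) => Pit.
  exists (fun f => a * f t + c1 f), c2; split=> // [|f]; first by right.
  by rewrite cE addrA.
exists c1, (fun f => a * f t + c2 f); split=> // [|f]; first by right.
by rewrite cE addrCA.
Qed.

(** Cutting a cochain off outside [Q] does not change the value of [c], because [c] is supported on
    [Q]; in the expression of [c] over [P] it removes the tuples outside [Q]. *)
Lemma chain_and (X : eqType) (P Q : seq X -> Prop) (c : (seq X -> F) -> F) :
  chain_on P c -> chain_on Q c -> chain_on (fun t => P t /\ Q t) c.
Proof.
move=> cP cQ; pose cut (f : seq X -> F) t := if `[< Q t >] then f t else 0.
apply: (@eq_chain _ _ _ (fun f => c (cut f))).
  by move=> f; apply: (chain_ext cQ) => t Qt; rewrite /cut asboolT.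
apply: chain_bind cP => t Pt; rewrite /cut; case: asboolP => Qt.
  by apply: chain1.
by left.
Qed.

Variables (R : realType) (N : nat).
Local Notation X := 'rV[R]_N.
Implicit Types (d e r a b c : R) (k : nat) (x y : X) (z w : (seq X -> F) -> F).

Lemma bounds_add A e k z1 z2 :
  bounds A e k z1 -> bounds A e k z2 -> bounds A e k (fun f => z1 f + z2 f).
Proof.
case=> [w1 w1A w1E] [w2 w2A w2E]; exists (fun f => w1 f + w2 f).
  exact: chainD.
by move=> f; rewrite w1E w2E.
Qed.

Lemma bounds_point (A : X -> Prop) d e q z : A q -> 0 <= e ->
  chain_on (small A d 0) z -> closed_chain z -> bounds A e 0 z.
Proof.
move=> Aq e0; apply: (bounds_cone (q := q)) => t [/size0nil -> _ _].
split=> // [x|x y]; first by rewrite inE => /eqP ->.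
by rewrite !inE => /eqP -> /eqP ->; apply: near_refl.
Qed.

Lemma cube_boundary_inhabited (m : 'I_N) : exists x, @cube_boundary R N m x.
Proof.
exists (\row_i (i == m)%:R); split.
- by move=> i; rewrite mxE; case: eqP; rewrite ?normr1 ?normr0.
- by exists m; rewrite mxE eqxx normr1.
- by move=> i mi; rewrite mxE; case: eqP => // im; rewrite im ltnn in mi.
Qed.

(** A small tuple may straddle the equator, where coordinate [m] is 0; collapsing a band around the
    equator puts it into one closed half. *)
Definition flatten_at (m : 'I_N) d x : X :=
  \row_i if (i == m) && (`|x 0 i| <= d) then 0 else x 0 i.

Lemma flatten_move m d x : 0 <= d -> near_pts d x (flatten_at m d x).
Proof.
move=> d0 i; rewrite mxE; case: ifP => [/andP[_]|_]; first by rewrite subr0.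
by rewrite subrr normr0.
Qed.

Lemma flatten_cube (m : 'I_N) d x :
  d < 1 -> cube_boundary m x -> cube_boundary m (flatten_at m d x).
Proof.
move=> d1 [x1 [i0 xi0] xm]; split.
- by move=> i; rewrite mxE; case: ifP; rewrite ?normr0.
- exists i0; rewrite mxE; case: ifP => // /andP[_].
  by rewrite xi0 leNgt d1.
- by move=> i mi; rewrite mxE; case: ifP => // _; apply: xm.
Qed.

(** If some entry has coordinate [m] above [d], all entries are positive there; otherwise flattening
    makes them all nonpositive. The factor 3 counts the original distance and two displacements. *)
Lemma small_flatten (m : 'I_N) d k (t : seq X) : 0 <= d -> d < 1 ->
    small (cube_boundary m) d k t ->
  small (half_cube m 1) (3%:R * d) k (map (flatten_at m d) t) \/
  small (half_cube m (-1)) (3%:R * d) k (map (flatten_at m d) t).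
Proof.
move=> d0 d1 tQ.
have [sz sQ sd] : small (cube_boundary m) (3%:R * d) k (map (flatten_at m d) t).
  apply: small_map tQ; first by move=> x; apply: flatten_cube.
  move=> x y _ _ xy; have -> : 3%:R * d = d + d + d by ring.
  apply: near_trans (flatten_move m y d0); apply: near_trans xy.
  exact/near_sym/flatten_move.
case: tQ => _ _ td; have [[x xt xm]|/forall2NP tneg] := pselect (exists2 x, x \in t & d < x 0 m).
  left; split=> // _ /mapP[y yt ->]; split; first by apply: sQ; apply: map_f.
  rewrite mul1r mxE eqxx /=; case: ifP => // _.
  by have := td _ _ xt yt m; rewrite ler_norml => /andP[? ?]; lra.
right; split=> // _ /mapP[y yt ->]; split; first by apply: sQ; apply: map_f.
rewrite mulN1r oppr_ge0 mxE eqxx /=; case: ifP => // /negbT.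
rewrite ler_norml negb_and -!ltNge; case: (tneg y) => // /negP; rewrite -leNgt => yd.
by move=> /orP[]; lra.
Qed.

(** Induction on [m]: the halves are contractible by [half_bounds] and meet in the boundary of the
    cube of one dimension less. The bound [k <= m] on entries means dimension below [m]. *)
Lemma cube_boundary_acyclic m e : (m < N)%N -> 0 < e ->
  exists2 d : R, 0 < d & forall k z, (k <= m)%N ->
    chain_on (small (cube_boundary m) d k) z -> closed_chain z ->
    bounds (cube_boundary m) e k z.
Proof.
elim: m e => [|m IHm] e mN e0.
  exists 1 => // k z; rewrite leqn0 => /eqP ->.
  have [q qQ] := cube_boundary_inhabited (Ordinal mN).
  exact: bounds_point qQ (ltW e0).
have e20 : 0 < e / 2%:R by rewrite divr_gt0.
have [d0 d0_gt0 Hd0] := IHm _ (ltnW mN) e20.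
(* Flattened tuples are [3 d]-small: this must be at most [d0] for the equator and [e / 2] for the
   halves. A [d] below 1 keeps flattened points on the boundary of the cube. *)
pose d := Num.min (Num.min (d0 / 3%:R) (e / 6%:R)) (1 / 2%:R).
have dgt0 : 0 < d by rewrite !lt_min !divr_gt0.
have [d1 d2 d3] : [/\ d <= d0 / 3%:R, d <= e / 6%:R & d <= 1 / 2%:R].
  by split; rewrite !ge_min lexx ?orbT.
exists d => // -[|k] z km zQ zc.
  have [q qQ] := cube_boundary_inhabited (Ordinal mN).
  exact: bounds_point qQ (ltW e0) zQ zc.
pose mi := Ordinal mN.
have dle1 : d < 1 by lra.
apply: (bounds_homotopy (B := cube_boundary mi) (phi := flatten_at mi d)
          (ltW dgt0) (ltW dgt0) _ _ _ _ _ zQ zc).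
- by lra.
- by [].
- by move=> x; apply: flatten_cube.
- by move=> x _; apply: flatten_move; apply: ltW.
- move=> x y _ _ xy; have : d + d + d <= e by lra.
  move=> /near_le; apply; apply: near_trans (flatten_move mi y (ltW dgt0)).
  by apply: near_trans xy; apply/near_sym/flatten_move/ltW.
have z'c := closed_chain_map (flatten_at mi d) zc.
have /(chain_split (fun t => id)) [z1 [z2 [z1H z2H zE]]] :
    chain_on (fun t => small (half_cube mi 1) (3%:R * d) k.+1 t \/
                       small (half_cube mi (-1)) (3%:R * d) k.+1 t)
      (fun f => z (fun s => f (map (flatten_at mi d) s))).
  apply: chain_bind zQ => t /(small_flatten (m := mi) (ltW dgt0) dle1).
  exact: chain1.
have bd s (u : (seq X -> F) -> F) : chain_on (small (half_cube mi s) (3%:R * d) k.+1) u ->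
    chain_on (small (half_cube mi s) (3%:R * d) k) (fun f => u (cobord f)).
  apply: chain_cobord => t s0 [sz tH td] /mem_subseq ut szu.
  split; first by move: szu; rewrite sz => -[].
    by move=> x /ut/tH.
  by move=> x y /ut xt /ut yt; apply: td.
have z12 f : z1 (cobord f) = - z2 (cobord f).
  by apply/eqP; rewrite -addr_eq0 -zE; apply/eqP; apply: z'c.
(* The boundary of [z1] is minus that of [z2], so it is supported on both halves, hence on the
   equator. *)
have bz : chain_on (small (cube_boundary m) d0 k) (fun f => z1 (cobord f)).
  have b2 : chain_on (small (half_cube mi (-1)) (3%:R * d) k) (fun f => z1 (cobord f)).
    by apply: eq_chain (chainN (bd _ _ z2H)) => f; rewrite z12.
  apply: chain_sub (chain_and (bd _ _ z1H) b2) => t [[sz tH td] [_ tH' _]].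
  split=> // [x xt|x y xt yt]; last first.
    by apply: near_le (td _ _ xt yt); lra.
  have [[x1 xi0 xm] x0] := tH _ xt; have [_ x0'] := tH' _ xt.
  split=> // i mi'; have [im|im] := eqVneq i mi.
    by rewrite im; apply: le_anti; apply/andP; split; lra.
  by apply: xm; rewrite ltn_neqAle mi' andbT eq_sym; apply: contra_neq im => /val_inj.
have [w wQ wE] : bounds (cube_boundary m) (e / 2%:R) k (fun f => z1 (cobord f)).
  apply: Hd0 => // f; rewrite -[RHS](chain_zero z1H); congr z1.
  by apply/funext => t; rewrite /cobord wcobordK.
have wH s : chain_on (small (half_cube mi s) (e / 2%:R) k.+1) w.
  apply: chain_sub wQ => t; apply: small_sub => // x [x1 xi0 xm].
  split; last by rewrite xm ?mulr0.
  by split=> // i mi'; apply: xm; apply: leq_trans mi'.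
have dE : 3%:R * d <= e / 2%:R by lra.
have e2e : e / 2%:R < e by lra.
have sub s (u : (seq X -> F) -> F) : chain_on (small (half_cube mi s) (3%:R * d) k.+1) u ->
    chain_on (small (half_cube mi s) (e / 2%:R) k.+1) u.
  by apply: chain_sub => t; apply: small_sub.
(* [w] fills the boundary of [z1] inside the equator, so [z1 - w] and [z2 + w] are cycles in the two
   halves; they add up to the flattened chain. *)
have b1 : bounds (cube_boundary m.+1) e k.+1 (fun f => z1 f - w f).
  apply: bounds_sub (half_bounds (m := mi) (sg := 1) _ (ltW e20) e2e _ _) => //.
  - by move=> x [].
  - by rewrite mulr1.
  - exact: chainB (sub _ _ z1H) (wH _).
  - by move=> f; rewrite wE subrr.
have b2 : bounds (cube_boundary m.+1) e k.+1 (fun f => z2 f + w f).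
  apply: bounds_sub (half_bounds (m := mi) (sg := -1) _ (ltW e20) e2e _ _) => //.
  - by move=> x [].
  - by rewrite mulrNN mulr1.
  - exact: chainD (sub _ _ z2H) (wH _).
  - by move=> f; rewrite wE z12 subrr.
have [u uQ uE] := bounds_add b1 b2; exists u => // f.
by rewrite uE zE; ring.
Qed.

End MayerVietoris.

(** * Alternating cochains on labels *)

Section LabelCochains.
Local Open Scope ring_scope.
Variables (p d : nat).
Hypothesis p_prime : prime p.
Local Notation L := ('I_d * 'Z_p)%type.
Implicit Types (f : seq L -> 'Z_p) (a x y : L) (b r : seq L) (s t : 'Z_p) (k i : nat).

Definition shift s b := map (translate s) b.

(** These are the faces of the join of [d] boundaries of simplices, one for each column. *)
Definition columns_proper b := [forall j : 'I_d, exists t : 'Z_p, (j, t) \notin b].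

(** Vanishing on repeated labels is a separate condition because the sign rule does not imply it
    when [p = 2]. *)
Definition alternating f :=
  (forall b1 x y b2, f (b1 ++ x :: y :: b2) = - f (b1 ++ y :: x :: b2)) /\
  (forall b1 x b2, f (b1 ++ x :: x :: b2) = 0).

Definition face_cochain k f :=
  [/\ alternating f, forall b, f b != 0 -> columns_proper b
    & forall b, f b != 0 -> size b = k].

(* On alternating cochains, which represent oriented chains on the labels, the
   boundary needs no signs. *)
Definition bd f b := \sum_x f (x :: b).

(* g - 1 and the norm, alternately, as in the periodic resolution of Z/p. *)
Definition tate i f b :=
  if odd i then f (shift (-1) b) - f b else \sum_s f (shift (- s) b).

Lemma shiftD s t b : shift s (shift t b) = shift (t + s) b.
Proof. by rewrite /shift -map_comp; apply: eq_map => x; rewrite /translate /= addrA. Qed.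

Lemma shift0 b : shift 0 b = b.
Proof. by rewrite /shift map_id_in // => -[j t] _; rewrite /translate /= addr0. Qed.

Lemma translate_inj s : injective (@translate p d s).
Proof.
by apply: (can_inj (g := translate (- s))) => -[j t]; rewrite /translate /= addrK.
Qed.

Lemma mem_shift s b j t : ((j, t) \in shift s b) = ((j, t - s) \in b).
Proof.
have -> : (j, t) = translate s (j, t - s) by rewrite /translate /= subrK.
by rewrite mem_map //; apply: translate_inj.
Qed.

Lemma columns_proper_shift s b : columns_proper (shift s b) = columns_proper b.
Proof.
apply/forallP/forallP => H j; have /existsP[t tb] := H j; apply/existsP.
  by exists (t - s); rewrite -mem_shift.
by exists (t + s); rewrite mem_shift addrK.
Qed.

Lemma eq_columns_proper b b' : b =i b' -> columns_proper b = columns_proper b'.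
Proof. by move=> bb; apply: eq_forallb => j; apply: eq_existsb => t; rewrite bb. Qed.

Lemma alternating_lin s f f' :
  alternating f -> alternating f' -> alternating (fun b => s * f b + f' b).
Proof.
move=> [fa f0] [fa' f0']; split=> [b1 x y b2|b1 x b2]; last by rewrite f0 f0' mulr0 addr0.
by rewrite fa fa' opprD mulrN.
Qed.

Lemma face_cochain_lin k s f f' : face_cochain k f -> face_cochain k f' ->
  face_cochain k (fun b => s * f b + f' b).
Proof.
move=> [fa fK fk] [fa' fK' fk']; split; first exact: alternating_lin.
  move=> b; apply: contraNT => nK; apply/eqP.
  rewrite (eqP (negbNE (contra (fK b) nK))) (eqP (negbNE (contra (fK' b) nK))).
  by rewrite mulr0 addr0.
move=> b fb; apply/eqP; apply: contraNT fb => nk.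
have -> : f b = 0 by apply: contraNeq nk => /fk ->.
have -> : f' b = 0 by apply: contraNeq nk => /fk' ->.
by rewrite mulr0 addr0.
Qed.

Lemma face_cochain0 k : face_cochain k (fun=> 0).
Proof.
by split=> [|b|b]; rewrite ?eqxx //; split=> *; rewrite ?oppr0.
Qed.

Lemma face_cochainN k f : face_cochain k f -> face_cochain k (fun b => - f b).
Proof.
move=> fk; have := face_cochain_lin (-1) fk (face_cochain0 k).
by congr face_cochain; apply/funext => b; rewrite mulN1r addr0.
Qed.

Lemma face_cochainB k f f' : face_cochain k f -> face_cochain k f' ->
  face_cochain k (fun b => f b - f' b).
Proof.
move=> fk /face_cochainN fk'; have := face_cochain_lin 1 fk fk'.
by congr face_cochain; apply/funext => b; rewrite mul1r.
Qed.

Lemma face_cochain_sum k (I : finType) (f : I -> seq L -> 'Z_p) :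
    (forall j, face_cochain k (f j)) ->
  face_cochain k (fun b => \sum_j f j b).
Proof.
move=> fk; suff H (e : seq I) : face_cochain k (fun b => \sum_(j <- e) f j b) by exact: H.
elim: e => [|j e IHe].
  have := face_cochain0 k; congr face_cochain.
  by apply/funext => b; rewrite big_nil.
have := face_cochain_lin 1 (fk j) IHe; congr face_cochain.
by apply/funext => b; rewrite big_cons mul1r.
Qed.

Lemma face_cochain_shift k s f :
  face_cochain k f -> face_cochain k (fun b => f (shift s b)).
Proof.
move=> [[fa f0] fK fk]; split.
- by split=> *; rewrite /shift !map_cat /= ?f0 // fa.
- by move=> b /fK; rewrite columns_proper_shift.
- by move=> b /fk; rewrite size_map.
Qed.

Lemma face_cochain_tate k i f : face_cochain k f -> face_cochain k (tate i f).
Proof.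
move=> fk; rewrite /tate; case: (odd i).
  by apply: face_cochainB => //; apply: face_cochain_shift.
by apply: face_cochain_sum => s; apply: face_cochain_shift.
Qed.

Lemma face_cochain_weight k (u : seq L -> 'Z_p) f :
    (forall b b', b =i b' -> u b = u b') ->
  face_cochain k f -> face_cochain k (fun b => u b * f b).
Proof.
move=> ub [[fa f0] fK fk].
have u0 b : u b * f b != 0 -> f b != 0 by apply: contra_neq => ->; rewrite mulr0.
split; [split=> [b1 x y b2|b1 x b2]|by move=> b /u0/fK|by move=> b /u0/fk].
  rewrite fa mulrN; congr (- (_ * _)); apply: ub => z.
  by rewrite !mem_cat !inE !(orbCA (z == x)).
by rewrite f0 mulr0.
Qed.

Lemma face_cochain_bd k f : face_cochain k.+1 f -> face_cochain k (bd f).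
Proof.
move=> [[fa f0] fK fk].
have ex b : bd f b != 0 -> exists x, f (x :: b) != 0.
  apply: contra_neqP => /forallNP H; rewrite /bd big1 // => x _.
  by apply/eqP; rewrite -[_ == _]negbK; apply/negP/H.
split.
- split=> [b1 x y b2|b1 x b2].
    by rewrite /bd -sumrN; apply: eq_bigr => z _; rewrite -!cat_cons fa.
  by rewrite /bd big1 // => z _; rewrite -!cat_cons f0.
- move=> b /ex[x /fK /forallP xb]; apply/forallP => j.
  have /existsP[t] := xb j; rewrite inE negb_or => /andP[_ tb].
  by apply/existsP; exists t.
- by move=> b /ex[x /fk] [].
Qed.

(** The diagonal terms vanish and the terms for [x, y] and [y, x] cancel. Induction on the range
    common to both sums pairs them off without a division by 2. *)
Lemma bd_bd k f b : face_cochain k f -> bd (bd f) b = 0.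
Proof.
move=> [[fa f0] _ _]; rewrite /bd.
suff H (r : seq L) : \sum_(x <- r) \sum_(y <- r) f (y :: x :: b) = 0 by exact: H.
elim: r => [|z r IHr]; first by rewrite big_nil.
rewrite big_cons big_cons (f0 [::]) add0r.
rewrite [X in _ + X](eq_bigr
  (fun x => f (z :: x :: b) + \sum_(y <- r) f (y :: x :: b))); last first.
  by move=> x _; rewrite big_cons.
rewrite big_split /= IHr addr0 -big_split /= big1 // => x _ /=.
by rewrite (fa [::]) addNr.
Qed.

Lemma bd_shift s f b : bd (fun b => f (shift s b)) b = bd f (shift s b).
Proof.
by rewrite /bd [RHS](reindex_inj (h := translate s)) //; apply: translate_inj.
Qed.

Lemma bd_tate i f b : bd (tate i f) b = tate i (bd f) b.
Proof.
rewrite /tate; case: (odd i); first by rewrite -bd_shift -sumrB.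
rewrite /bd exchange_big; apply: eq_bigr => s _.
exact: (bd_shift (- s) f b).
Qed.

(** Translation by 1 permutes the summands of the norm, so the norm and the difference annihilate
    each other. *)
Lemma tate_tate i f b : tate i.+1 (tate i f) b = 0.
Proof.
rewrite /tate /=; case: (odd i) => /=.
  rewrite sumrB [X in _ - X](reindex_inj (h := fun s => s + 1)) /=; last exact: addIr.
  by apply/eqP; rewrite subr_eq0; apply/eqP; apply: eq_bigr => s _; rewrite shiftD -opprD.
apply/eqP; rewrite subr_eq0; apply/eqP.
rewrite [RHS](reindex_inj (h := fun s => s + 1)) /=; last exact: addIr.
by apply: eq_bigr => s _; rewrite shiftD -opprD addrC.
Qed.

Lemma p_gt1 : (1 < p)%N. Proof. exact: prime_gt1. Qed.

Definition column b (j : 'I_d) := [set t : 'Z_p | (j, t) \in b]%SET.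

(* The mean of the elements of the first nonempty column; it is equivariant
   because p does not divide the size of a nonempty proper subset of Z/p. *)
Definition phase b : 'Z_p :=
  if [pick j | column b j != finset.set0] is Some j
  then (\sum_(t in column b j) t) / #|column b j|%:R else 0.

Lemma eq_phase b b' : b =i b' -> phase b = phase b'.
Proof.
move=> bb; have E j : column b j = column b' j by apply/setP => t; rewrite !inE bb.
rewrite /phase (eq_pick (fun j => congr1 (fun A => A != finset.set0) (E j))).
by case: pickP => // j _; rewrite E.
Qed.

Lemma phase_shift s b : b != [::] -> columns_proper b ->
  phase (shift s b) = phase b + s.
Proof.
move=> b0 /forallP bK.
have E j : column (shift s b) j = [set t + s | t in column b j]%SET.
  apply/setP => t; rewrite inE mem_shift; apply/idP/imsetP.
    by move=> H; exists (t - s); rewrite ?inE ?subrK.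
  by case=> t'; rewrite inE => H ->; rewrite addrK.
have E0 j : (column (shift s b) j != finset.set0) = (column b j != finset.set0).
  by rewrite E -!card_gt0 card_imset //; apply: addIr.
rewrite /phase (eq_pick E0); case: pickP => [j jb|none]; last first.
  case: b b0 none {bK E E0} => // -[j t] b _ /(_ j) /negbFE/eqP/setP/(_ t).
  by rewrite !inE eqxx.
have /existsP[t0 t0b] := bK j.
have U : (#|column b j|%:R : 'Z_p) \is a GRing.unit.
  rewrite unitZpE ?p_gt1 // prime_coprime //; apply/negP => /dvdn_leq.
  rewrite card_gt0 => /(_ jb); rewrite leqNgt => /negP; apply.
  have cardZp : #|[set: 'Z_p]%SET| = p by rewrite cardsT card_ord Zp_cast ?p_gt1.
  apply: leq_trans (eq_leq cardZp); apply: proper_card; rewrite properT.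
  by apply: contraNneq t0b => /setP/(_ t0); rewrite !inE.
rewrite E card_imset; last exact: addIr.
rewrite big_imset /=; last by move=> ? ? _ _ /addIr.
by rewrite big_split /= sumr_const mulrDl -[s *+ _]mulr_natr mulrK.
Qed.

End LabelCochains.

(** * Exactness of the periodic resolution and descent to dimension 0 *)

Section Descent.
Local Open Scope ring_scope.
Variables (p d : nat).
Hypothesis p_prime : prime p.
Local Notation L := ('I_d * 'Z_p)%type.
Implicit Types (f g : seq L -> 'Z_p) (a x y : L) (b r : seq L) (s t : 'Z_p) (k i : nat).

Lemma shift_eq0 s b : (shift s b == [::]) = (b == [::]).
Proof. by rewrite -!size_eq0 size_map. Qed.

Lemma sum_Zp_nat (G : 'Z_p -> 'Z_p) : \sum_s G s = \sum_(0 <= m < (Zp_trunc p).+2) G m%:R.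
Proof. by rewrite big_mkord; apply: eq_bigr => s _; rewrite natr_Zp. Qed.

Lemma face_cochain_nz k f b : face_cochain k.+1 f -> f b != 0 ->
  b != [::] /\ columns_proper b.
Proof.
move=> [_ fK fk] fb; split; last exact: fK.
by rewrite -size_eq0 (fk _ fb).
Qed.

(** Here [f] is invariant under shifts. Each orbit of a nonempty face has exactly one member of
    [phase] 0, so [f] is the norm of its part of phase 0. *)
Lemma tate_exact_norm k i f : ~~ odd i -> face_cochain k.+1 f ->
    (forall b, tate i.+1 f b = 0) ->
  exists2 g, face_cochain k.+1 g & forall b, f b = tate i g b.
Proof.
move=> oi fk f0; rewrite /tate /= oi in f0.
have fs s b : f (shift (- s) b) = f b.
  rewrite -[s]natr_Zp; elim: (s : nat) b => [|m IHm] b; first by rewrite oppr0 shift0.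
  rewrite -natr1 opprD -shiftD -[RHS]IHm.
  by apply/eqP; rewrite -subr_eq0 f0.
exists (fun b => (phase b == 0)%:R * f b).
  by apply: face_cochain_weight => // b b' /eq_phase ->.
move=> b; rewrite /tate (negPf oi); have [fb0|fb] := eqVneq (f b) 0.
  by rewrite big1 // => s _; rewrite fs fb0 mulr0.
have [b0 bK] := face_cochain_nz fk fb.
rewrite (bigD1 (phase b)) //= big1 ?addr0 => [|s sb].
  by rewrite fs phase_shift // subrr eqxx mul1r.
by rewrite phase_shift // subr_eq0 eq_sym (negPf sb) mul0r.
Qed.

(** Here the norm of [f] vanishes. Summing [f] along each orbit, starting from [phase] 0, gives a
    discrete primitive. *)
Lemma tate_exact_diff k i f : odd i -> face_cochain k.+1 f ->
    (forall b, tate i.+1 f b = 0) ->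
  exists2 g, face_cochain k.+1 g & forall b, f b = tate i g b.
Proof.
move=> oi fk f0; rewrite /tate /= oi in f0.
(* Indicator weights replace a range of summation depending on [b], which exhibits [g] as a sum of
   weighted face cochains. *)
pose g b := - \sum_(m < (Zp_trunc p).+2) (m < phase b)%N%:R * f (shift (- m%:R) b).
have gE b : g b = - \sum_(0 <= m < phase b) f (shift (- m%:R) b).
  rewrite /g; congr (- _).
  rewrite -(big_mkord xpredT
    (fun m => (m < phase b)%N%:R * f (shift (- m%:R) b))).
  rewrite (big_cat_nat (n := phase b)) //=; last exact/ltnW/ltn_ord.
  rewrite [X in _ + X]big_nat_cond [X in _ + X]big1 ?addr0.
    by apply: eq_big_nat => m /andP[_ ->]; rewrite mul1r.
  by move=> m /andP[/andP[+ _] _]; rewrite leqNgt => /negPf ->; rewrite mul0r.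
exists g.
  apply: face_cochainN; apply: face_cochain_sum => m.
  have ub b b' : b =i b' -> (m < phase b)%N%:R = (m < phase b')%N%:R :> 'Z_p.
    by move=> /eq_phase ->.
  exact: face_cochain_weight ub (face_cochain_shift _ fk).
move=> b; rewrite /tate oi; have [|nb] := boolP ((b != [::]) && columns_proper b); last first.
  have fz s : f (shift s b) = 0.
    apply/eqP; apply: contraNT nb => /(face_cochain_nz fk).
    by rewrite shift_eq0 columns_proper_shift => -[-> ->].
  rewrite -[b in LHS]shift0 fz !gE !big1 ?subrr // => m _; by rewrite ?shiftD fz.
case/andP=> b0 bK; rewrite !gE phase_shift //.
(* At phase 0 the previous phase wraps around to [p - 1], and the vanishing of the norm closes the
   orbit; elsewhere the sums telescope. *)
have [ph|ph] := eqVneq (phase b) 0.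
  rewrite ph [in X in _ - X]big_geq // oppr0 subr0 sub0r.
  have -> : nat_of_ord (-1 : 'Z_p) = (Zp_trunc p).+1 by rewrite /= modn_small // subn1.
  have := f0 b; rewrite sum_Zp_nat big_nat_recl //= oppr0 shift0.
  move/eqP; rewrite addr_eq0 => /eqP ->; congr (- _); apply: eq_bigr => m _.
  by rewrite shiftD -natr1 opprD addrC.
have -> : nat_of_ord (phase b - 1) = (phase b).-1.
  have ph0 : (0 < phase b)%N by rewrite lt0n; apply: contra_neq ph => e; apply/val_inj.
  rewrite sub_Zp_1 /= -{1}(prednK ph0) addSn /=.
  by rewrite modnDr modn_small // (leq_ltn_trans (leq_pred _)) ?ltn_ord.
have ph0 : (0 < phase b)%N by rewrite lt0n; apply: contra_neq ph => e; apply/val_inj.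
rewrite -[in X in _ - - X](prednK ph0) big_nat_recl // oppr0 shift0 opprK addrCA.
rewrite (eq_bigr (fun m => f (shift (- m.+1%:R) b))) ?addNr ?addr0 // => m _.
by rewrite shiftD -natr1 opprD addrC.
Qed.

Lemma tate_exact k i f : face_cochain k.+1 f -> (forall b, tate i.+1 f b = 0) ->
  exists2 g, face_cochain k.+1 g & forall b, f b = tate i g b.
Proof. by case: (boolP (odd i)) => oi; [apply: tate_exact_diff|apply: tate_exact_norm]. Qed.

Lemma tateB i f g b : tate i (fun b => f b - g b) b = tate i f b - tate i g b.
Proof.
rewrite /tate; case: (odd i); first by ring.
by rewrite -sumrB.
Qed.

(** At each level [f i] is corrected by a boundary until the next operator kills it: if the
    corrected [f i.+1] is [tate i.+1 h], then [f i - bd h] is killed by [tate i.+1]. *)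
Lemma tate_descent n (f : nat -> seq L -> 'Z_p) :
    (forall i, (i <= n)%N -> face_cochain i.+1 (f i)) ->
    bd (f 0%N) [::] = 1 ->
    (forall i b, (i < n)%N -> bd (f i.+1) b = tate i.+1 (f i) b) ->
  ~ (forall b, tate n.+1 (f n) b = 0).
Proof.
move=> fk f01 fS fn0.
suff H m : (m <= n)%N -> exists2 g, face_cochain (n - m).+1 g &
    (forall b, bd g b = bd (f (n - m)%N) b) /\ (forall b, tate (n - m).+1 g b = 0).
  have [g gk [gE g0]] := H n (leqnn n); rewrite subnn in gk gE g0.
  have [h _ hE] := tate_exact gk g0.
  suff : 1 = 0 :> 'Z_p by apply/eqP/oner_neq0.
  have p0 q : q = p -> q%:R = 0 :> 'Z_p by move=> ->; rewrite pchar_Zp ?prime_gt1.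
  (* [tate 0] is the norm and shifts fix the empty tuple, so the augmentation is [p] times that of
     [h]. *)
  rewrite -f01 -gE (funext hE) bd_tate /tate /= sumr_const card_ord.
  by rewrite -mulr_natr p0 ?mulr0 // Zp_cast // prime_gt1.
elim: m => [|m IHm] mn; first by rewrite subn0; exists (f n); auto.
have [g gk [gE g0]] := IHm (ltnW mn).
have E : (n - m = (n - m.+1).+1)%N by rewrite subnSK.
rewrite E in gk gE g0; set i := (n - m.+1)%N in gk gE g0 *.
have [h hk hE] := tate_exact gk g0.
have iltn : (i < n)%N by rewrite /i -E leq_subr.
exists (fun b => f i b - bd h b).
  by apply: face_cochainB; [apply: fk; apply: ltnW|apply: face_cochain_bd].
split=> b.
  rewrite /bd sumrB -[X in _ - X]/(bd (bd h) b) (bd_bd _ hk).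
  by rewrite subr0.
by rewrite tateB -fS // -gE (funext hE) bd_tate subrr.
Qed.

End Descent.

(** * Top-dimensional cycles of the label complex *)

Section Pseudomanifold.
Local Open Scope ring_scope.
Variables (p d : nat).
Hypothesis p_prime : prime p.
Local Notation L := ('I_d * 'Z_p)%type.
Implicit Types (f g : seq L -> 'Z_p) (a x y : L) (b r : seq L) (t : 'Z_p) (k i : nat)
  (s : 'I_d -> 'Z_p).

Definition transversal_facet s : {set L} := [set a | a.2 != s a.1]%SET.

Lemma alternating_move f c b x r : alternating f ->
  f (c ++ b ++ x :: r) = (-1) ^+ size b * f (c ++ x :: b ++ r).
Proof.
move=> [fa _]; elim: b c => [|y b IHb] c /=; first by rewrite mul1r.
by rewrite -cat_rcons IHb cat_rcons fa exprS mulN1r mulNr mulrN.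
Qed.

Lemma alternating_front f b x r : alternating f ->
  (f (b ++ x :: r) == 0) = (f (x :: b ++ r) == 0).
Proof.
move=> fa; rewrite (alternating_move [::] b x r fa) /=.
by rewrite -signr_odd mulr_sign; case: (odd _); rewrite ?oppr_eq0.
Qed.

Lemma alternating_uniq f b : alternating f -> f b != 0 -> uniq b.
Proof.
move=> fa; suff H c : f (c ++ b) != 0 -> uniq b by apply: (H [::]).
elim: b c => //= y b IHb c; rewrite -cat_rcons => fb.
rewrite (IHb _ fb) andbT; apply: contraNN fb => yb.
case/splitPr: yb => b1 b2; rewrite (alternating_move _ _ _ _ fa) cat_rcons.
by case: fa => _ ->; rewrite mulr0.
Qed.

Lemma card_transversal_facet s : #|transversal_facet s| = ((p - 1) * d)%N.
Proof.
have cC : #|~: transversal_facet s| = d.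
  have -> : (~: transversal_facet s = [set (j, s j) | j : 'I_d])%SET.
    apply/setP => -[j t]; rewrite !inE /= negbK; apply/eqP/imsetP.
      by move=> ->; exists j.
    by case=> j' _ [-> ->].
  by rewrite card_imset ?card_ord // => j j' [].
have := cardsC (transversal_facet s).
have -> : #|{: L}| = (d * p)%N by rewrite card_prod !card_ord Zp_cast ?prime_gt1.
by rewrite cC mulnBl mul1n mulnC => <-; rewrite addnK.
Qed.

(** Each of the [d] columns misses a label, and [(p - 1) * d] distinct labels leave room for only
    one missing label per column. *)
Lemma facet_is_transversal f b : face_cochain ((p - 1) * d) f -> f b != 0 ->
  exists s, b =i transversal_facet s.
Proof.
move=> [fa fK fk] fb; have /forallP bK := fK _ fb.
have ub := alternating_uniq fa fb.
pose s j := if [pick t | (j, t) \notin b] is Some t then t else 0.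
have sb j : (j, s j) \notin b.
  rewrite /s; case: pickP => // none.
  by have /existsP[t tb] := bK j; have := none t; rewrite tb.
exists s => a; have -> : transversal_facet s = [set a in b]%SET; last by rewrite inE.
apply/esym/eqP; rewrite eqEcard; apply/andP; split.
  apply/fintype.subsetP => -[j t]; rewrite !inE /= => jb.
  by apply: contraTneq jb => ->; exact: sb.
rewrite card_transversal_facet -(fk _ fb) -(card_uniqP ub).
by apply/eq_leq/eq_card => x; rewrite inE.
Qed.

(* A ridge obtained from a facet by dropping a label in column j lies in only
   one other facet, so the value at one facet propagates to all. *)
Lemma top_cycle_eq0 s0 f : face_cochain ((p - 1) * d) f ->
    (forall b, bd f b = 0) -> (forall b, b =i transversal_facet s0 -> f b = 0) ->
  forall b, f b = 0.
Proof.
move=> fk bdf f0; have [fa fK _] := fk.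
(* [m] bounds the number of columns in which the facet of [s] differs from that of [s0]. *)
suff H m s b : (#|[set j | s j != s0 j]%SET| <= m)%N -> b =i transversal_facet s -> f b = 0.
  move=> b; have [//|fb] := eqVneq (f b) 0.
  by have [s bs] := facet_is_transversal fk fb; apply: H bs; exact: leqnn.
elim: m s b => [|m IHm] s b.
  rewrite leqn0 cards_eq0 => /eqP/setP ss0 bs; apply: f0 => a; rewrite bs !inE.
  by have := ss0 a.1; rewrite !inE => /negbFE/eqP ->.
have [eqs|/existsP[j sj]] := boolP [forall j, s j == s0 j].
  move=> _ bs; apply: f0 => a; rewrite bs !inE.
  by rewrite (eqP (forallP eqs a.1)).
move=> cm bs; apply/eqP; apply: contraTT isT => fb.
have ab : (j, s0 j) \in b by rewrite bs inE /= eq_sym.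
have := alternating_uniq fa fb; have bsz : size b = ((p - 1) * d)%N by case: fk => _ _; apply.
case/splitPr: ab bs fb bsz => b1 b2 bs fb bsz ub.
rewrite (alternating_front _ _ _ fa) in fb; set r := b1 ++ b2 in fb.
have rE x : (x \in r) = (x != (j, s0 j)) && (x.2 != s x.1).
  have := bs x; rewrite inE /r !mem_cat inE => <-.
  move: ub; rewrite -cat1s uniq_catCA /= mem_cat => /andP[/norP[n1 n2] _].
  by case: eqP => [->|_] /=; rewrite ?(negPf n1) ?(negPf n2).
have := bdf r; rewrite /bd (bigD1 (j, s0 j)) //= (bigD1 (j, s j)) /=; last first.
  by apply: contra_neq sj => -[].
(* The other facet through the ridge [r] agrees with that of [s0] in column [j] too, so the
   induction hypothesis applies to it. *)
rewrite [f ((j, s j) :: r)](IHm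
  (fun i : 'I_d => if i == j then s0 j else s i)) ?add0r; last 2 first.
- rewrite -ltnS; apply: leq_trans cm; apply: proper_card; apply/fintype.properP; split.
    by apply/fintype.subsetP => i; rewrite !inE; case: (eqVneq i j) => [->|] //; rewrite eqxx.
  by exists j; rewrite !inE ?eqxx /= ?eqxx ?sj.
- move=> [i t]; rewrite !inE rE /= !xpair_eqE; case: (eqVneq i j) => [->|_] //=.
  by have [->|] := eqVneq t (s j); rewrite ?andbT //= sj.
rewrite big1 ?addr0 => [fa0|[i t] /andP[a1 a2]].
  by rewrite fa0 eqxx in fb.
(* Any further label either repeats one of [r] or completes a column other than [j]. *)
have [ir|ir] := boolP ((i, t) \in r).
  have : ~~ uniq ((i, t) :: r) by rewrite /= ir.
  by apply: contraNeq; apply: alternating_uniq.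
apply/eqP; apply: contraTT isT => /fK/forallP/(_ i)/existsP[u].
rewrite inE negb_or rE /= negb_and !negbK => /andP[iu].
rewrite rE a1 /= negbK in ir; rewrite (eqP ir) in iu a2.
case/orP => [/eqP[ij _]|/eqP us]; last by rewrite us eqxx in iu.
by rewrite ij eqxx in a2.
Qed.

End Pseudomanifold.

(** * From chains of points to cochains on labels *)

Section LabelledChains.
Local Open Scope ring_scope.
Variables (p d : nat).
Hypothesis p_prime : prime p.
Local Notation L := ('I_d * 'Z_p)%type.
Implicit Types (a b r : seq L) (x y : L) (s : 'Z_p) (k i : nat).

(** [tate n.+1 (f n)] is a top cycle, and it vanishes on the transversal facet because [f n]
    vanishes on all its translates. It is therefore zero, against [tate_descent]. *)
Lemma no_cochain_system n (f : nat -> seq L -> 'Z_p) (s0 : 'I_d -> 'Z_p) :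
    n.+1 = ((p - 1) * d)%N ->
    (forall i, (i <= n)%N -> face_cochain i.+1 (f i)) ->
    bd (f 0%N) [::] = 1 ->
    (forall i b, (i < n)%N -> bd (f i.+1) b = tate i.+1 (f i) b) ->
  ~ (forall s b, shift s b =i transversal_facet s0 -> f n b = 0).
Proof.
move=> nE fk f01 fS fT; apply: (tate_descent p_prime fk f01 fS).
apply: (top_cycle_eq0 p_prime (s0 := s0)).
- by rewrite -nE; apply: face_cochain_tate; apply: fk.
(* For [n = 0] there is no earlier relation, but [bd (f 0)] lives on the empty tuple, which shifts
   fix, so its difference vanishes. *)
- move=> b; rewrite bd_tate; case: n {nE} fk fS fT => [|n] fk fS _; last first.
    by rewrite (funext (fun b => fS n b (ltnSn n))) tate_tate.
  have [_ _ bk] := face_cochain_bd (fk 0%N (leqnn _)).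
  rewrite /tate /=; have [->|b0] := eqVneq b [::]; first by rewrite subrr.
  have bz b' : b' != [::] -> bd (f 0%N) b' = 0.
    by move=> b'0; apply: contraNeq b'0 => /bk/size0nil ->.
  by rewrite !bz ?subrr // shift_eq0.
- move=> b bT; rewrite /tate.
  have fz s : f n (shift s b) = 0.
    by apply: (fT (- s)) => x; rewrite shiftD subrr shift0.
  by case: (odd _); [rewrite fz -[b]shift0 fz subr0|rewrite big1].
Qed.

(* [minor b a] is the determinant of the matrix of the Kronecker deltas of the
   entries of a and b, expanded along the first entry of b: the coefficient of
   the oriented simplex b in the ordered simplex a. *)
Fixpoint minor b : seq L -> 'Z_p :=
  if b is x :: b' then wcobord (fun y => (y == x)%:R) (minor b')
  else fun a => (a == [::])%:R.

Lemma wcobord_neq0 (w : L -> 'Z_p) (f : seq L -> 'Z_p) a : wcobord w f a != 0 ->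
  exists a1 y a2, [/\ a = a1 ++ y :: a2, w y != 0 & f (a1 ++ a2) != 0].
Proof.
elim: a f => [|y a IHa] f /=; first by [].
have [wf|wf _] := eqVneq (w y * f a) 0; last first.
  exists [::], y, a; split=> //; first by apply: contra_neq wf => ->; rewrite mul0r.
  by apply: contra_neq wf => ->; rewrite mulr0.
rewrite wf sub0r oppr_eq0 => /IHa[a1 [z [a2 [-> wz fz]]]].
by exists (y :: a1), z, a2.
Qed.

Lemma minor_perm b a : minor b a != 0 -> perm_eq a b.
Proof.
elim: b a => [|x b IHb] a /=; first by case: (a =P [::]) => [->|_]; rewrite ?eqxx.
move=> /wcobord_neq0[a1 [y [a2 [-> yx /IHb ab]]]].
have -> : y = x by apply/eqP; apply: contraNT yx => /negPf ->.
by rewrite perm_catC /= perm_cons perm_catC.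
Qed.

(** Past the common prefix these are [wcobord_anti] and [wcobordK] for Kronecker weights. *)
Lemma minor_alternating a : alternating (minor^~ a).
Proof.
split=> [b1 x y b2|b1 x b2].
  elim: b1 a => [|z b1 IHb] a /=; first exact: wcobord_anti.
  by rewrite -wcobordN; apply: eq_wcobord => t; apply: IHb.
elim: b1 a => [|z b1 IHb] a /=; first exact: wcobordK.
rewrite -[RHS](wcobord0 (fun y => (y == z)%:R) a).
by apply: eq_wcobord => t; apply: IHb.
Qed.

Lemma minor_shift s b a : minor (shift s b) (shift s a) = minor b a.
Proof.
elim: b a => [|x b IHb] a /=; first by rewrite shift_eq0.
rewrite /shift wcobord_map -(funext IHb); congr wcobord.
by apply/funext => y; rewrite (inj_eq (@translate_inj _ _ s)).
Qed.

(** Kronecker weights sum to the constant weight 1; this makes the passage from ordered to oriented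
    simplices a chain map. *)
Lemma sum_minor b a : \sum_x minor (x :: b) a = cobord (minor b) a.
Proof.
rewrite -wcobord_sumw; congr wcobord; apply/funext => y.
by rewrite (bigD1 y) //= big1 ?addr0 ?eqxx // => x; rewrite eq_sym => /negPf ->.
Qed.

Lemma chain_neq0 (F : comNzRingType) (X : eqType) (P : seq X -> Prop) c (f : seq X -> F) :
  chain_on P c -> c f != 0 -> exists2 t, P t & f t != 0.
Proof.
elim=> [|a t c' Pt _ IHc]; first by rewrite eqxx.
have [ft|ft _] := eqVneq (f t) 0; last by exists t.
by rewrite ft mulr0 add0r.
Qed.

Variables (X : eqType) (lam : X -> L).
Implicit Types (c : (seq X -> 'Z_p) -> 'Z_p).

(** The coefficient of the oriented simplex [b] in the image of the chain [c] under the
    labelling. *)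
Definition label_cochain c b := c (fun t => minor b (map lam t)).

Lemma label_cochain_support (P : seq X -> Prop) c b : chain_on P c ->
  label_cochain c b != 0 -> exists2 t, P t & perm_eq (map lam t) b.
Proof.
by move=> cP /(chain_neq0 cP)[t Pt /minor_perm]; exists t.
Qed.

Lemma label_cochain_face (P : seq X -> Prop) k c :
    (forall t, P t -> size t = k /\ columns_proper (map lam t)) ->
  chain_on P c -> face_cochain k (label_cochain c).
Proof.
move=> PK cP; split.
- split=> [b1 x y b2|b1 x b2]; rewrite /label_cochain.
    rewrite -(chain_opp _ cP); congr c; apply/funext => t.
    by have [-> _] := minor_alternating (map lam t).
  rewrite -[RHS](chain_zero cP); congr c; apply/funext => t.
  by have [_ ->] := minor_alternating (map lam t).
- move=> b /(label_cochain_support cP)[t /PK[_ tK] /perm_mem tb].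
  by rewrite -(eq_columns_proper tb).
- by move=> b /(label_cochain_support cP)[t /PK[tk _] /perm_size <-]; rewrite size_map.
Qed.

Lemma bd_label_cochain (P : seq X -> Prop) c b : chain_on P c ->
  bd (label_cochain c) b = label_cochain (fun f => c (cobord f)) b.
Proof.
move=> cP; rewrite /bd /label_cochain -(chain_sumf _ _ cP); congr c.
apply/funext => t; rewrite sum_minor /cobord wcobord_map //.
Qed.

Lemma label_cochain_shift (P : seq X -> Prop) (phi : X -> X) s c b :
    (forall t (x : X), P t -> x \in t -> lam (phi x) = translate s (lam x)) ->
    chain_on P c ->
  label_cochain (fun f => c (fun t => f (map phi t))) b
    = label_cochain c (shift (- s) b).
Proof.
move=> phis cP; apply: (chain_ext cP) => t Pt.
rewrite -[RHS](minor_shift s) shiftD addNr shift0; congr minor.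
by rewrite /shift -!map_comp; apply/eq_in_map => x xt; apply: phis Pt xt.
Qed.

End LabelledChains.

(** * Equivariant systems of small chains *)

Section EquivariantSystem.
Local Open Scope ring_scope.
Variables (R : realType) (p d n : nat).
Hypothesis p_prime : prime p.
Hypothesis nE : n.+1 = ((p - 1) * d)%N.
Local Notation X := 'rV[R]_n.+1.
Local Notation L := ('I_d * 'Z_p)%type.
Local Notation Q := (@cube_boundary R n.+1 n).
Variables (g : 'Z_p -> X -> X) (lam : X -> L).
Hypothesis gQ : forall s x, Q x -> Q (g s x).
Hypothesis gD : forall s t x, g s (g t x) = g (s + t) x.
Hypothesis g_uniform : forall e : R, 0 < e -> exists2 dl : R, 0 < dl &
  forall s x y, Q x -> Q y -> near_pts dl x y -> near_pts e (g s x) (g s y).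
Hypothesis lam_g : forall s x, Q x -> lam (g s x) = translate s (lam x).
Implicit Types (c : (seq X -> 'Z_p) -> 'Z_p) (e : R).

(** The counterpart of [tate] on chains: pushing a chain forward by [g s] makes its coefficient at
    [b] the old one at [shift (- s) b], whence the signs in [tate]. *)
Definition chain_tate i c (f : seq X -> 'Z_p) :=
  if odd i then c (fun u => f (map (g 1) u)) - c f
  else \sum_s c (fun u => f (map (g s) u)).

Lemma chain_tate_on dl e k i c :
    (forall s x y, Q x -> Q y -> near_pts dl x y -> near_pts e (g s x) (g s y)) ->
    dl <= e ->
  chain_on (small Q dl k) c -> chain_on (small Q e k) (chain_tate i c).
Proof.
move=> gu de cQ.
have cs s : chain_on (small Q e k) (fun f => c (fun u => f (map (g s) u))).
  by apply: chain_map cQ => [x|x y]; [apply: gQ|apply: gu].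
rewrite /chain_tate; case: (odd i); last exact: chain_sum.
by apply: chainB => //; apply: chain_sub cQ => u; apply: small_sub.
Qed.

Lemma chain_tate_cobord i c f :
  chain_tate i c (cobord f) = chain_tate i (fun f => c (cobord f)) f.
Proof.
have E s : (fun u => cobord f (map (g s) u)) = cobord (fun u => f (map (g s) u)).
  by apply/funext => u; rewrite cobord_map.
rewrite /chain_tate; case: (odd i); first by rewrite E.
by apply: eq_bigr => s _; rewrite E.
Qed.

Lemma chain_tate_tate i c f : chain_tate i.+1 (chain_tate i c) f = 0.
Proof.
have E s t : (fun u => f (map (g s) (map (g t) u))) = (fun u => f (map (g (s + t)) u)).
  by apply/funext => u; rewrite -map_comp; congr f; apply: eq_map => x /=.
rewrite /chain_tate /=; case: (odd i) => /=.
  rewrite sumrB [X in _ - X](reindex_inj (h := fun s => s + 1)) /=; last exact: addIr.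
  by apply/eqP; rewrite subr_eq0; apply/eqP; apply: eq_bigr => s _; rewrite E.
apply/eqP; rewrite subr_eq0; apply/eqP.
rewrite [RHS](reindex_inj (h := fun s => 1 + s)) /=; last exact: addrI.
by apply: eq_bigr => s _; rewrite E.
Qed.

(** Starting from a point, each [chain_tate i.+1 (c i)] is a cycle and is filled by acyclicity.
    Fillings are coarser than what they fill, so the earlier chains are taken at a finer scale
    determined by [e]. *)
Lemma equivariant_system i e : (i <= n)%N -> 0 < e ->
  exists c : nat -> (seq X -> 'Z_p) -> 'Z_p,
    [/\ forall j, (j <= i)%N -> chain_on (small Q e j.+1) (c j),
        forall f, c 0%N (cobord f) = f [::]
      & forall j f, (j < i)%N -> c j.+1 (cobord f) = chain_tate j.+1 (c j) f].
Proof.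
elim: i e => [|i IHi] e iN e0.
  have [q qQ] := @cube_boundary_inhabited R n.+1 ord_max.
  exists (fun _ f => f [:: q]); split=> [j|f|//]; last first.
    by rewrite /cobord /= mul1r subr0.
  rewrite leqn0 => /eqP ->; apply: chain1; split=> // [x|x y].
    by rewrite inE => /eqP ->.
  by rewrite !inE => /eqP -> /eqP ->; apply: near_refl; apply: ltW.
have [d1 d1_gt0 Hd1] := @cube_boundary_acyclic 'Z_p R n.+1 n e (ltnSn n) e0.
have [d2 d2_gt0 Hd2] := g_uniform d1_gt0.
(* [d1] is the scale at which cycles can be filled, [d2] the one that the action carries into
   [d1]. *)
pose e' := Num.min e (Num.min d1 d2).
have e'0 : 0 < e' by rewrite !lt_min e0 d1_gt0.
have [ee ed1 ed2] : [/\ e' <= e, e' <= d1 & e' <= d2].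
  by split; rewrite !ge_min lexx ?orbT.
have [c [cQ c0 cS]] := IHi e' (ltnW iN) e'0.
have [w wQ wE] : bounds Q e i.+1 (chain_tate i.+1 (c i)).
  apply: Hd1 => //.
    apply: chain_tate_on (cQ _ (leqnn i)) => // s x y Qx Qy xy.
    by apply: Hd2 => //; apply: near_le xy.
  (* For [i = 0] the boundary is the augmentation, on which the difference vanishes; for larger [i]
     two consecutive operators compose to zero. *)
  move=> f; rewrite chain_tate_cobord; case: i {IHi} iN cQ cS => [|i] iN cQ cS.
    by rewrite /chain_tate /= !c0 /= subrr.
  have -> : (fun f => c i.+1 (cobord f)) = chain_tate i.+1 (c i).
    by apply/funext => f'; apply: cS.
  exact: chain_tate_tate.
exists (fun j => if j == i.+1 then w else c j); split=> //.
- move=> j; rewrite leq_eqVlt; case: eqP => [-> //|_] /= ji.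
  by apply: chain_sub (cQ _ _) => // u; apply: small_sub.
- move=> j f; rewrite ltnS eqSS => ji; rewrite (ltn_eqF (ji : (j < i.+1)%N)).
  by case: eqP => [->|/eqP ni] //; apply: cS; rewrite ltn_neqAle ni.
Qed.

Lemma label_cochain_tate (P : seq X -> Prop) i c b :
    (forall u x, P u -> x \in u -> Q x) -> chain_on P c ->
  label_cochain lam (chain_tate i c) b = tate i (label_cochain lam c) b.
Proof.
move=> PQ cP.
have H s : c (fun u => minor b (map lam (map (g s) u))) = label_cochain lam c (shift (- s) b).
  rewrite -(label_cochain_shift (phi := g s) b _ cP) // => u x Pu xu.
  by apply: lam_g; apply: PQ Pu xu.
rewrite [LHS]/(chain_tate _ _ _) /tate; case: (odd i); first by rewrite H.
by apply: eq_bigr => s _; rewrite H.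
Qed.

Lemma no_small_labelling (s0 : 'I_d -> 'Z_p) e : 0 < e ->
    (forall k u, small Q e k u -> columns_proper (map lam u)) ->
  ~ (forall k u s, small Q e k u -> ~ (shift s (map lam u) =i transversal_facet s0)).
Proof.
move=> e0 uK uT; have [c [cQ c0 cS]] := equivariant_system (leqnn n) e0.
have PQ k u x : small Q e k u -> x \in u -> Q x by move=> [_ uQ _]; apply: uQ.
apply: (no_cochain_system p_prime (f := fun i => label_cochain lam (c i)) (s0 := s0) nE).
- move=> i iN; apply: label_cochain_face (cQ _ iN) => u us; split; last exact: uK us.
  by case: us.
- by rewrite (bd_label_cochain _ _ (cQ _ (leq0n n))) /label_cochain c0.
- move=> i b iN; rewrite (bd_label_cochain _ _ (cQ _ iN)).
  rewrite -(label_cochain_tate _ _ (@PQ _) (cQ _ (ltnW iN))).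
  by rewrite /label_cochain cS.
- move=> s b bT; apply/eqP; apply: contraT.
  move=> /(label_cochain_support (cQ _ (leqnn n)))[u us /perm_mem ub].
  case: (uT _ _ s us) => -[j t]; rewrite -bT !mem_shift; exact: ub.
Qed.

End EquivariantSystem.

(** * Radial projection between the cube and the sphere *)

Section RadialProjection.
Local Open Scope classical_set_scope.
Local Open Scope ring_scope.
Variables (R : realType) (n : nat).
Local Notation X := 'rV[R]_n.+1.
Local Notation S := (sphere R n : Type).
Local Notation Q := (@cube_boundary R n.+1 n).
Implicit Types (x y : X) (dl e : R).

Lemma rV_norm_le x e : 0 <= e -> (`|x| <= e) <-> (forall i, `|x 0 i| <= e).
Proof.
move=> e0; rewrite [X in X <= _]mx_normrE; split.
  move=> /bigmax_leP[_ H] i; exact: (H (0, i)).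
by move=> H; apply/bigmax_leP; split=> // -[i j] _ /=; rewrite (ord1 i).
Qed.

Lemma cube_boundaryE x : Q x <-> `|x| = 1.
Proof.
split=> [[x1 [i xi] _]|x1].
  apply/eqP; rewrite eq_le; apply/andP; split; first exact/rV_norm_le.
  rewrite -xi; have := lexx `|x|; rewrite {1}(rV_norm_le _ (normr_ge0 x)).
  exact.
have x_le1 : `|x| <= 1 by rewrite x1.
split; first exact/rV_norm_le.
  have /mx_norm_neq0[[i j]] : mx_norm x != 0 by rewrite -[mx_norm x]/`|x| x1 oner_eq0.
  by rewrite -[mx_norm x]/`|x| x1 /= (ord1 i) => ->; exists j.
by move=> i; rewrite ltnNge -ltnS ltn_ord.
Qed.

Lemma compact_cube_boundary : compact [set x | Q x].
Proof.
apply: bounded_closed_compact.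
  exists 1; split; first exact: num_real.
  by move=> M M1 x /cube_boundaryE /= ->; apply: ltW.
rewrite (_ : [set x | Q x] = (fun x : X => `|x|) @^-1` [set 1]); last first.
  by apply/seteqP; split=> x /cube_boundaryE.
by apply: closed_comp; [move=> x _; apply: norm_continuous|apply: closed_eq].
Qed.

(** Heine-Cantor, with the common radius supplied by the near-covering form of compactness. *)
Lemma compact_uniform (A : set X) (f : X -> R) e : compact A ->
    (forall x, A x -> f z @[z --> x] --> f x) -> 0 < e ->
  exists2 dl : R, 0 < dl &
    forall x y, A x -> A y -> near_pts dl x y -> `|f x - f y| <= e.
Proof.
move=> /compact_near_coveringP cA cf e0.
have : \forall dl \near (0 : R)^'+, A `<=`
    (fun x => forall y, A y -> near_pts dl x y -> `|f x - f y| <= e).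
  apply: cA => x Ax.
  have /cvgrPdist_le /(_ (e / 2%:R)) := cf _ Ax.
  rewrite divr_gt0 // => /(_ isT) /nbhs_normP[r /= r0 xr].
  have r20 : 0 < r / 2%:R by rewrite divr_gt0.
  near=> x' dl => /= y Ay x'y.
  have xx' : `|x - x'| < r / 2%:R.
    by near: x'; rewrite near_simpl; apply/nbhs_normP; exists (r / 2%:R).
  have dlr : dl < r / 2%:R by near: dl; apply: nbhs_right_lt.
  have dl0 : 0 < dl by near: dl; apply: nbhs_right_gt.
  have x'y' : `|x' - y| <= dl.
    by apply/rV_norm_le; [exact: ltW|move=> i; rewrite !mxE; apply: x'y].
  have xy : `|x - y| < r.
    by rewrite -(subrKA x'); apply: le_lt_trans (ler_normD _ _) _; lra.
  have fx' : `|f x - f x'| <= e / 2%:R by apply: xr => /=; lra.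
  have fy : `|f x - f y| <= e / 2%:R by apply: xr.
  rewrite -(subrKA (f x)); apply: le_trans (ler_normD _ _) _.
  by rewrite [`|f x' - _|]distrC; lra.
move=> H; near (0 : R)^'+ => dl; exists dl; first by near: dl; apply: nbhs_right_gt.
by have := near H dl => /(_ _) HA x y Ax Ay; apply: HA.
Unshelve. all: by end_near. Qed.

Definition sumsq x := \sum_i x 0 i ^+ 2.

Lemma sumsq_gt0 x : x != 0 -> 0 < sumsq x.
Proof.
move=> x0; rewrite lt_neqAle sumr_ge0 ?andbT => [|i _]; last exact: sqr_ge0.
apply: contra_neq x0 => /esym/eqP; rewrite psumr_eq0 => [/allP H|i _]; last exact: sqr_ge0.
apply/rowP => i; rewrite mxE; apply/eqP; rewrite -sqrf_eq0.
by apply: H; rewrite mem_index_enum.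
Qed.

Lemma sumsqZ a x : sumsq (a *: x) = a ^+ 2 * sumsq x.
Proof. by rewrite mulr_sumr; apply: eq_bigr => i _; rewrite mxE exprMn. Qed.

Lemma delta_in_sphere : delta_mx 0 0 \in sphere R n.
Proof.
apply/mem_set; rewrite /sphere /= (bigD1 0) //= big1 ?addr0.
  by rewrite mxE eqxx expr1n.
by move=> i /negPf i0; rewrite mxE i0 andbF expr0n.
Qed.

(* At x = 0 the value is an arbitrary point of the sphere. *)
Definition sphere_proj x : S :=
  insubd (exist (fun x => x \in sphere R n) _ delta_in_sphere)
    ((Num.sqrt (sumsq x))^-1 *: x).

Lemma val_sphere_proj x : x != 0 ->
  val (sphere_proj x) = (Num.sqrt (sumsq x))^-1 *: x.
Proof.
move=> x0; apply: insubdK; apply/mem_set; rewrite /sphere /= -/(sumsq _) sumsqZ.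
by rewrite exprVn sqr_sqrtr ?mulVf // ?gt_eqF ?sumsq_gt0 // ltW ?sumsq_gt0.
Qed.

Definition cube_proj (y : S) : X := `|val y|^-1 *: val y.

Lemma sphere_sumsq (y : S) : sumsq (val y) = 1.
Proof. by case: y => y /= /set_mem. Qed.

Lemma sphere_neq0 (y : S) : val y != 0.
Proof.
apply/eqP => y0; have := sphere_sumsq y; rewrite y0 /sumsq big1 => [/esym/eqP|i _].
  by rewrite oner_eq0.
by rewrite mxE expr0n.
Qed.

Lemma cube_projQ (y : S) : Q (cube_proj y).
Proof.
apply/cube_boundaryE; rewrite normrZ normfV normr_id mulVf //.
by rewrite normr_eq0 sphere_neq0.
Qed.

Lemma cube_boundary_neq0 x : Q x -> x != 0.
Proof. by move=> /cube_boundaryE x1; rewrite -normr_eq0 x1 oner_eq0. Qed.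

Lemma sphere_projK : cancel cube_proj sphere_proj.
Proof.
move=> y; apply: val_inj; have a0 : 0 < `|val y|^-1 by rewrite invr_gt0 normr_gt0 sphere_neq0.
rewrite val_sphere_proj; last exact/cube_boundary_neq0/cube_projQ.
rewrite /cube_proj sumsqZ sphere_sumsq mulr1 sqrtr_sqr gtr0_norm // scalerA.
by rewrite mulVf ?scale1r // gt_eqF.
Qed.

Lemma cube_proj_continuous : continuous cube_proj.
Proof.
move=> y; have vy : val z @[z --> y] --> (val y : X) by exact: initial_continuous.
have fy : Filter (nbhs y) := nbhs_filter y.
have ny : `|val z| @[z --> y] --> `|val y : X| by exact: (cvg_norm vy).
by apply: cvgZ => //; apply: cvgV ny; rewrite normr_eq0 sphere_neq0.
Qed.

Lemma sphere_proj_continuous x : Q x -> sphere_proj z @[z --> x] --> sphere_proj x.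
Proof.
move=> Qx; have x0 := cube_boundary_neq0 Qx.
have cv : val (sphere_proj z) @[z --> x] --> (val (sphere_proj x) : X).
  rewrite (val_sphere_proj x0).
  have nx : \forall z \near x,
      (Num.sqrt (sumsq z))^-1 *: z = val (sphere_proj z).
    near=> z; rewrite val_sphere_proj //; near: z.
    by apply: (cvgr_neq0 (f := id)) x0; apply: cvg_id.
  apply: cvg_trans (near_eq_cvg nx) _.
  apply: cvgZ; last exact: cvg_id.
  apply: cvgV; first by rewrite sqrtr_eq0 -ltNge sumsq_gt0.
  apply: (@cvg_comp _ _ _ sumsq Num.sqrt); last exact: sqrt_continuous.
  apply: cvg_big => [|i _]; first exact: add_continuous.
  by apply: (continuous_comp (f := fun z : X => z 0 i) (g := fun r => r ^+ 2));
    [exact: coord_continuous|exact: exprn_continuous].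
(* Neighbourhoods in the sphere come from open sets [B] of the ambient space, so convergence of the
   underlying vectors suffices. *)
move=> U [_ [[B Bop <-] Bx sBU]].
have xB : nbhs x [set z | B (val (sphere_proj z))].
  by apply: cv; apply: open_nbhs_nbhs.
by apply: (filterS (F := nbhs x) _ xB) => z; apply: sBU.
Unshelve. all: by end_near. Qed.

End RadialProjection.

(** * Labelling the points of the sphere *)

Section Labels.
Local Open Scope ring_scope.
Variables (p d : nat).
Local Notation L := ('I_d * 'Z_p)%type.

(** One label is chosen for a representative of each orbit and translated along the orbit; freeness
    makes the translation unambiguous. *)
Lemma equivariant_selection (T : choiceType) (act : 'Z_p -> T -> T) (P : T -> L -> Prop) :
    (forall x, act 0 x = x) -> (forall s t x, act (s + t) x = act s (act t x)) ->
    free_action act ->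
    (forall y, exists a, P y a) ->
    (forall s y a, P y a -> P (act s y) (translate s a)) ->
  exists lam : T -> L,
    (forall y, P y (lam y)) /\ (forall s y, lam (act s y) = translate s (lam y)).
Proof.
move=> act0 actD act_free Pex Pact.
pose orb y : set T := [set z | exists s, z = act s y]%classic.
pose rep y := xget y (orb y).
have orbE s y : orb (act s y) = orb y.
  apply/seteqP; split=> z /= [t ->]; first by exists (t + s); rewrite actD.
  by exists (t - s); rewrite -actD subrK.
have rep_ex y : exists s, y = act s (rep y).
  have [s rs] : orb y (rep y) by apply: (xgetI y (x := y)); exists 0; rewrite act0.
  by exists (- s); rewrite rs -actD addNr act0.
have repE s y : rep (act s y) = rep y.
  (* The two calls of [xget] differ only in their default, which is never reached since the orbit is
     nonempty. *)
  rewrite /rep orbE /xget; case: pselect => // -[]; exists y; apply/asboolP.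
  by exists 0; rewrite act0.
have [sh shE] := choice rep_ex; have [a aP] := choice Pex.
exists (fun y => translate (sh y) (a (rep y))); split=> [y|s y].
  by rewrite {1}[y]shE; apply: Pact.
suff -> : sh (act s y) = sh y + s by rewrite repE /translate /= addrA.
have := shE (act s y); rewrite repE {1}[y]shE -actD => e.
apply/eqP; rewrite eq_sym addrC -subr_eq0; apply: contraT => ne0.
case: (act_free _ (act (sh (act s y)) (rep y)) ne0).
by rewrite -actD subrK.
Qed.

Variables (V : finType) (K : {set {set V}}) (ell : V -> L).
Hypothesis Kc : simplicial_complex K.

Lemma full_column_face (A : {set V}) j : (1 < p)%N -> A \in K ->
    (forall t, exists2 v, v \in A & ell v = (j, t)) ->
  exists sigma : {set V}, kface K (p - 1) sigma
    /\ (ell @: sigma = [set (j, t) | t : 'Z_p])%SET.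
Proof.
move=> p1 AK Aj; have p0 := ltnW p1.
have /choice[v vP] t : exists v, v \in A /\ ell v = (j, t).
  by have [v] := Aj t; exists v.
exists [set v t | t : 'Z_p]%SET; split.
  split.
    apply: Kc AK _; apply/fintype.subsetP => _ /imsetP[t _ ->].
    by have [] := vP t.
  rewrite card_imset ?card_ord ?Zp_cast ?subn1 ?prednK // => t t' e.
  by have := congr1 ell e; rewrite !(vP _).2 => -[].
rewrite -imset_comp; apply: eq_imset => t /=; by rewrite (vP t).2.
Qed.

(** [A] extends to a facet. A label [(j, s0 j)] on that facet would complete column [j] and yield
    the excluded face. *)
Lemma transversal_face (A : {set V}) (s0 : 'I_d -> 'Z_p) : (1 < p)%N -> A \in K ->
    ~ (exists (sigma : {set V}) (j : 'I_d), kface K (p - 1) sigma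
        /\ (ell @: sigma = [set (j, t) | t : 'Z_p])%SET) ->
    (forall a, a.2 != s0 a.1 -> exists2 v, v \in A & ell v = a) ->
  exists sigma : {set V}, facet K sigma
    /\ (ell @: sigma = [set a : L | a.2 != s0 a.1])%SET.
Proof.
move=> p1 AK nK AT; have [B maxB AB] := maxset_exists AK.
exists B; split=> //; apply/setP => -[j t]; rewrite inE /=.
apply/imsetP/idP => [[v vB e]|/(AT (j, t))[v vA <-]]; last first.
  by exists v => //; apply: (fintype.subsetP AB).
apply/negP => /eqP ts; apply: nK.
have [] := @full_column_face B j p1 _ _; last by move=> sigma H; exists sigma, j.
  exact: maxsetp maxB.
move=> t'; have [->|t's] := eqVneq t' (s0 j); first by exists v; rewrite // -e ts.
have [v' v'A v'E] := AT (j, t') t's.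
by exists v' => //; apply: (fintype.subsetP AB).
Qed.

End Labels.

Lemma exists_common_radius (R : realType) (I : finType) (P : I -> R -> Prop) :
    (forall i (a b : R), (a <= b)%R -> P i b -> P i a) ->
    (forall i, exists2 a : R, (0 < a)%R & P i a) ->
  exists2 a : R, (0 < a)%R & forall i, P i a.
Proof.
move=> Pm Pex; suff [a a0 aP] : exists2 a : R, (0 < a)%R & forall i, i \in enum I -> P i a.
  by exists a => // i; apply: aP; rewrite mem_enum.
elim: (enum I) => [|i r [a a0 IHr]]; first by exists 1%R.
have [b b0 Pb] := Pex i; exists (Num.min a b); first by rewrite lt_min a0.
move=> i'; rewrite inE => /orP[/eqP ->|/IHr]; last by apply: Pm; rewrite ge_min lexx.
by apply: Pm Pb; rewrite ge_min lexx orbT.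
Qed.

Section Realization.
Local Open Scope ring_scope.
Variables (R : realType) (V : finType) (K : {set {set V}}).

Lemma realization_face (x : realization R K) : [set v | val x v != 0]%SET \in K.
Proof. by case: x => x /= /set_mem[]. Qed.

Lemma realization_large_coordinate (x : realization R K) :
  exists v, #|V|%:R^-1 <= val x v.
Proof.
case: x => x /= /set_mem[x0 x1 _]; apply: contrapT => /forallNP H.
have V0 : (0 < #|V|)%N.
  rewrite lt0n; apply/eqP => V0; move: x1.
  rewrite big1 => [/eqP|v]; first by rewrite eq_sym oner_eq0.
  by have := card0_eq V0 v.
suff : \sum_v x v < 1 by rewrite x1 ltxx.
have [v0 _] : exists v0 : V, v0 \in V by apply/existsP; rewrite -/(negb (pred0b V)) -lt0n.
have -> : 1 = \sum_(v : V) #|V|%:R^-1 :> R.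
  by rewrite sumr_const -[RHS]mulr_natl mulfV // pnatr_eq0 -lt0n.
apply: ltr_sum => [|v _]; first by apply/hasP; exists v0; rewrite ?mem_index_enum.
by rewrite ltNge; apply/negP/H.
Qed.

(** [iota] has finite order, hence is injective, and the sum in [pushforward] has a single term. *)
Lemma realization_map_iter (p : nat) (iota : V -> V) (iotaK : simplicial_map K iota)
    m (x : realization R K) v :
    (0 < p)%N -> (forall v, iter p iota v = v) ->
  val (iter m (realization_map iotaK) x) (iter m iota v) = val x v.
Proof.
case: p => // p _ iotap; have iinj : injective iota.
  by apply: (can_inj (g := iter p iota)) => u; rewrite -iterSr iotap.
elim: m => //= m <-; rewrite /Defs.pushforward (big_pred1 (iter m iota v)) // => u.
by rewrite (inj_eq iinj).
Qed.

Lemma coordinate_continuous v : continuous (fun x : realization R K => val x v).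
Proof.
move=> x; apply: (continuous_comp (f := val : realization R K -> {ptws V -> R})
  (g := fun y : {ptws V -> R} => y v)); first exact: initial_continuous.
exact: (@proj_continuous V (fun=> R) v).
Qed.

End Realization.

(** * Transport of the action and of the barycentric coordinates to the cube *)

Section Transfer.
Local Open Scope ring_scope.
Variables (R : realType) (p n : nat).
Local Notation X := 'rV[R]_n.+1.
Local Notation S := (sphere R n : Type).
Local Notation Q := (@cube_boundary R n.+1 n).
Variable act : 'Z_p -> sphere R n -> sphere R n.
Hypothesis act_action : continuous_action act.

Definition cube_act s (x : X) : X := cube_proj (act s (sphere_proj x)).

Lemma cube_act_continuous s i x : Q x ->
  (cube_act s z 0 i @[z --> x] --> cube_act s x 0 i)%classic.
Proof.
move=> Qx.
have h1 : continuous (fun y : sphere R n => cube_proj (act s y) 0 i).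
  move=> y; apply: (continuous_comp (f := act s) (g := fun y => cube_proj y 0 i)).
    exact: act_continuous.
  apply: (continuous_comp (f := @cube_proj R n) (g := fun x : X => x 0 i)).
    exact: cube_proj_continuous.
  exact: coord_continuous.
exact: cvg_comp (sphere_proj_continuous Qx) (h1 _).
Qed.

Lemma cube_act_uniform (e : R) : 0 < e -> exists2 dl : R, 0 < dl &
  forall s x y, Q x -> Q y -> near_pts dl x y -> near_pts e (cube_act s x) (cube_act s y).
Proof.
move=> e0; have [|si|dl dl0 H] := @exists_common_radius R ('Z_p * 'I_n.+1)%type
  (fun si dl => forall x y, Q x -> Q y -> near_pts dl x y ->
    `|cube_act si.1 x 0 si.2 - cube_act si.1 y 0 si.2| <= e).
- move=> i a b ab H x y Qx Qy xy; apply: H => //; exact: near_le xy.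
- apply: (compact_uniform (f := fun x => cube_act si.1 x 0 si.2)
           (@compact_cube_boundary R n)) => //.
  exact: cube_act_continuous.
- by exists dl => // s x y Qx Qy xy i; apply: (H (s, i)).
Qed.

Variables (V : finType) (K : {set {set V}}) (k : sphere R n -> realization R K).
Hypothesis k_continuous : continuous k.

Lemma vertex_coordinates_uniform (e : R) : 0 < e -> exists2 dl : R, 0 < dl &
  forall v x y, Q x -> Q y -> near_pts dl x y ->
    `|val (k (sphere_proj x)) v - val (k (sphere_proj y)) v| <= e.
Proof.
move=> e0; apply: exists_common_radius => [v a b ab H x y Qx Qy xy|v].
  by apply: H => //; apply: near_le xy.
apply: (compact_uniform (f := fun x => val (k (sphere_proj x)) v)
         (@compact_cube_boundary R n)) => //.
move=> x Qx.
have h1 : continuous (fun y : sphere R n => val (k y) v).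
  move=> y; apply: (continuous_comp (f := k) (g := fun z : realization R K => val z v)).
    exact: k_continuous.
  exact: coordinate_continuous.
exact: cvg_comp (sphere_proj_continuous Qx) (h1 _).
Qed.

End Transfer.

(** * Contradiction from an equivariant labelling of the sphere *)

Theorem theorem6p1 (R : realType) (p d n : nat)
  (p_prime : prime p) (d_ge1 : (1 <= d)%N) (nE : n = ((p - 1) * d - 1)%N)
  (act : 'Z_p -> sphere R n -> sphere R n)
  (act_action : continuous_action act) (act_free : free_action act)
  (V : finType) (Sigma : {set {set V}}) (iota : V -> V)
  (h : realization R Sigma -> sphere R n)
  (Sigma_triangulation : equivariant_triangulation act iota h)
  (ell : V -> 'I_d * 'Z_p) (ell_equivariant : equivariant_labelling iota ell)
  (s_ : 'I_d -> 'Z_p) :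
  (exists (sigma : {set V}) (j : 'I_d),
     kface Sigma (p - 1) sigma
     /\ (ell @: sigma = [set (j, t) | t : 'Z_p])%SET)
  \/
  (exists sigma : {set V},
     facet Sigma sigma
     /\ (ell @: sigma = [set a : 'I_d * 'Z_p | a.2 != s_ a.1])%SET).
Proof.
have p1 := prime_gt1 p_prime; have p0 := prime_gt0 p_prime.
have nE1 : n.+1 = ((p - 1) * d)%N.
  by rewrite nE subn1 prednK // muln_gt0 subn_gt0 p1.
case: Sigma_triangulation => SK _ [k [hk kh _ k_cont]] iotap [iotaK hact].
have k_act s y : k (act s y) = iter s (realization_map iotaK) (k y).
  by apply: (can_inj hk); rewrite kh hact kh.
apply: contrapT => /not_orP[no1 no2].
(* Some barycentric coordinate is at least the mean [c], so each point admits the label of such a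
   vertex. *)
pose c : R := (#|V|%:R^-1)%R.
pose P y a := exists2 v, ell v = a & (c <= val (k y) v)%R.
have [||||s y _ [v <- vc]|lam [lamP lamact]] :=
    @equivariant_selection p d (sphere R n) act P.
- exact: act_zero act_action.
- exact: act_add act_action.
- exact: act_free.
- by move=> y; have [v vc] := realization_large_coordinate (k y); exists (ell v), v.
- exists (iter s iota v); first exact: ell_equivariant.
  by rewrite k_act (realization_map_iter iotaK s (k y) v p0 iotap).
have V0 : (0 < #|V|)%N.
  have [v _ _] := lamP (h (k (sphere_proj 0%R))).
  by apply/card_gt0P; exists v.
have c0 : (0 < c)%R by rewrite invr_gt0 ltr0n.
have c20 : (0 < c / 2%:R)%R by rewrite divr_gt0.
have [e e0 eP] := vertex_coordinates_uniform k_cont c20.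
pose lamX x := lam (sphere_proj x).
(* The face is the carrier of the first point: a coordinate of at least [c] at a nearby point is
   still at least [c / 2] there. *)
have u_face m u : small (@cube_boundary R n.+1 n) e m u -> u != [::] ->
    exists2 A, A \in Sigma & forall a, a \in map lamX u -> exists2 v, v \in A & ell v = a.
  case: u => // x u [_ uQ ue] _.
  exists [set v | val (k (sphere_proj x)) v != 0%R]%SET; first exact: realization_face.
  move=> a /mapP[y yu ->]; have [v vE vc] := lamP (sphere_proj y).
  exists v => //; rewrite inE gt_eqF //.
  have := eP v x y (uQ x (mem_head _ _)) (uQ _ yu) (ue _ _ (mem_head _ _) yu).
  by rewrite ler_norml => /andP[+ _]; lra.
apply: (@no_small_labelling R p d n p_prime nE1 (cube_act act) lamX _ _ _ _ s_ e e0).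
- by move=> s x _; apply: cube_projQ.
- by move=> s t x; rewrite /cube_act sphere_projK act_add.
- exact: cube_act_uniform.
- by move=> s x _; rewrite /lamX /cube_act sphere_projK lamact.
- move=> m u us; apply/forallP => j; apply/existsP; apply: contrapT => full.
  have fullP t : (j, t) \in map lamX u.
    by apply: contrapT => jt; apply: full; exists t; apply/negP.
  have u0 : u != [::] by apply: contraTneq (fullP 0%R) => ->.
  have [A AK AP] := u_face _ _ us u0.
  have [sigma sigmaP] := full_column_face SK p1 AK (fun t => AP _ (fullP t)).
  by apply: no1; exists sigma, j.
- move=> m u s us uT.
  have uTa a : a.2 != s_ a.1 -> a \in shift s (map lamX u).
    by move=> aT; rewrite uT inE.
  have u0 : u != [::].
    apply/eqP => u0; have : (0 < #|transversal_facet s_|)%N.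
      by rewrite card_transversal_facet // -nE1.
    by rewrite card_gt0 => /finset.set0Pn[a]; rewrite -uT u0.
  have [A AK AP] := u_face _ _ us u0.
  (* The labels form the transversal facet only after a shift by [s], so the face is moved by [iota]
     iterated [s] times. *)
  apply: no2; apply: (@transversal_face p d V Sigma ell SK
    (iter s (fun B : {set V} => iota @: B)%SET A) s_) => //.
    by elim: (nat_of_ord s) => //= m' IH; exact: (iotaK _ IH).
  move=> a /uTa /mapP[b /AP[v vA <-] ->].
  exists (iter s iota v); last exact: ell_equivariant.
  by elim: (nat_of_ord s) => //= m' IH; apply: imset_f.
Qed.
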